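(* Let $G=GL_n(\mathbb{C})$, let $N\in\mathfrak{g}=\mathfrak{gl}_n(\mathbb{C})$ be a regular nilpotent, and let $H$ be the subspace of $\mathfrak{g}$ given by $$H=\mathfrak{b}\oplus\bigoplus_{\alpha\in\Delta}\mathfrak{g}_{-\alpha}.$$ There is a natural bijection between the cells of the Peterson variety $\mathcal{H}(N,H)$ and the ordered partitions of $n$ (sequences of positive integers with sum $n$) such that, if $C=(c_1,\dots,c_k)$ is the cell whose associated ordered partition has parts $c_1,\dots,c_k$, then the complex dimension of $C$ is $n-k$. The number of cells with complex dimension $k$ is $\binom{n-1}{k}$.
   Context: A regular nilpotent is a nilpotent operator on $\mathbb{C}^n$ with a single Jordan block. Choose a basis of $\mathbb{C}^n$ in which $N$ is in (upper triangular) Jordan canonical form; $B$ is the group of invertible upper triangular matrices in this basis, $\mathfrak{b}$ its Lie algebra, $\Delta=\{\alpha_1,\dots,\alpha_{n-1}\}$ the simple roots with respect to the diagonal matrices and $\mathfrak{b}$ ($\mathfrak{g}_{\alpha_i}$ is spanned by the matrix unit $E_{i,i+1}$), so $H$ is the space of matrices that are zero below the subdiagonal. The Peterson variety is $\mathcal{H}(N,H)=\{gB\in G/B: g^{-1}Ng\in H\}$, equivalently the variety of full flags $V_1\subset\dots\subset V_n=\mathbb{C}^n$ with $NV_i\subseteq V_{i+1}$ for $i=1,\dots,n-1$. Its cells are the nonempty intersections $B\pi B\cap\mathcal{H}(N,H)$ with the Schubert cells $B\pi B\subset G/B$, $\pi\in S_n$; these are affine spaces and pave $\mathcal{H}(N,H)$.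 *)

(* Defs.v *)
From mathcomp Require Export all_boot all_order all_fingroup all_algebra.
From mathcomp Require Export complex mpoly.
From mathcomp Require Export boolp classical_sets functions cardinality reals.

Set Implicit Arguments.
Unset Strict Implicit.
Unset Printing Implicit Defensive.

Import GRing.Theory.

Local Open Scope classical_set_scope.
Local Open Scope ring_scope.

(* A topology on [T] is given by the family [closed] of its closed sets, and
   a subset [Y] carries the subspace topology. *)

Definition closed_in (T : Type) (closed : set (set T)) (Y : set T) :
    set (set T) :=
  [set Z | exists2 F, closed F & Z = F `&` Y].

Definition irreducible_set (T : Type) (closed : set (set T)) (Z : set T) : Prop :=
  Z !=set0 /\
  forall F1 F2, closed F1 -> closed F2 ->
    Z `<=` F1 `|` F2 -> Z `<=` F1 \/ Z `<=` F2.

(* A chain Z 0 < ... < Z m, of length m. *)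
Definition irreducible_chain (T : Type) (closed : set (set T)) (Y : set T)
    (m : nat) : Prop :=
  exists Z : nat -> set T,
    (forall i, (i <= m)%N ->
       closed_in closed Y (Z i) /\ irreducible_set closed (Z i)) /\
    (forall i, (i < m)%N -> Z i `<` Z i.+1).

Definition krull_dim (T : Type) (closed : set (set T)) (Y : set T)
    (d : nat) : Prop :=
  irreducible_chain closed Y d /\
  forall m, irreducible_chain closed Y m -> (m <= d)%N.

(* Matrices act on column vectors.  The columns of [P] are the chosen basis of
   C^n, so that [in_basis P A] is the matrix of the operator [A] in it. *)

Definition in_basis (R : realType) (n : nat) (P A : 'M[R[i]]_n) : 'M[R[i]]_n :=
  invmx P *m A *m P.

Definition nilpotent_jordan_block (R : realType) (n : nat) : 'M[R[i]]_n :=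
  \matrix_(i, j) (i.+1 == j :> nat)%:R.

Definition jordan_basis (R : realType) (n : nat) (P N : 'M[R[i]]_n) : Prop :=
  P \in unitmx /\ in_basis P N = nilpotent_jordan_block R n.

Definition regular_nilpotent (R : realType) (n : nat) (N : 'M[R[i]]_n) : Prop :=
  exists P, jordan_basis P N.

(* [is_trig_mx] means lower triangular. *)
Definition upper_triangular (R : realType) (n : nat) (A : 'M[R[i]]_n) : bool :=
  is_trig_mx A^T.

Definition GL_set (R : realType) (n : nat) : set 'M[R[i]]_n :=
  [set g | g \in unitmx].

Definition borel_group (R : realType) (n : nat) (P : 'M[R[i]]_n) :
    set 'M[R[i]]_n :=
  [set b | b \in unitmx /\ upper_triangular (in_basis P b)].

(* The root space of the negative of the simple root alpha_j is spanned, in the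
   basis P, by the matrix unit E_(j+1, j). *)
Definition hessenberg_space (R : realType) (n : nat) (P : 'M[R[i]]_n) :
    set 'M[R[i]]_n :=
  [set X | exists (Y : 'M[R[i]]_n) (a : 'I_n -> R[i]),
     upper_triangular Y /\
     in_basis P X =
       Y + \sum_(j < n) \sum_(i < n | i == j.+1 :> nat) a j *: delta_mx i j].

Definition borel_coset (R : realType) (n : nat) (P g : 'M[R[i]]_n) :
    set 'M[R[i]]_n :=
  [set g *m b | b in borel_group P].

Definition flag_variety (R : realType) (n : nat) (P : 'M[R[i]]_n) :
    set (set 'M[R[i]]_n) :=
  [set borel_coset P g | g in @GL_set R n].

Definition peterson_variety (R : realType) (n : nat) (P N : 'M[R[i]]_n) :
    set (set 'M[R[i]]_n) :=
  [set borel_coset P g |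
     g in [set g | GL_set g /\ hessenberg_space P (invmx g *m N *m g)]].

(* The operator permuting the basis by e_j |-> e_(s j). *)
Definition weyl_mx (R : realType) (n : nat) (P : 'M[R[i]]_n) (s : 'S_n) :
    'M[R[i]]_n :=
  P *m (perm_mx s)^T *m invmx P.

Definition schubert_cell (R : realType) (n : nat) (P : 'M[R[i]]_n) (s : 'S_n) :
    set (set 'M[R[i]]_n) :=
  [set borel_coset P (b *m weyl_mx P s) | b in borel_group P].

Definition peterson_cell (R : realType) (n : nat) (P N : 'M[R[i]]_n)
    (s : 'S_n) : set (set 'M[R[i]]_n) :=
  schubert_cell P s `&` peterson_variety P N.

Definition peterson_cells (R : realType) (n : nat) (P N : 'M[R[i]]_n) :
    set (set (set 'M[R[i]]_n)) :=
  [set C | C !=set0 /\ exists s : 'S_n, C = peterson_cell P N s].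

(* Polynomials in the entries cut out all closed subsets of GL_n: the
   coordinate 1/det is a unit on GL_n. *)
Definition zariski_closed_GL (R : realType) (n : nat) : set (set 'M[R[i]]_n) :=
  [set F | exists I : set {mpoly R[i][n * n]},
     F = [set g | GL_set g /\ forall p, I p -> p.@[mxvec g 0] = 0]].

(* G/B has the quotient topology of G -> G/B, which is open. *)
Definition zariski_closed_flag (R : realType) (n : nat) (P : 'M[R[i]]_n) :
    set (set (set 'M[R[i]]_n)) :=
  [set F | F `<=` flag_variety P /\
     zariski_closed_GL [set g | GL_set g /\ F (borel_coset P g)]].

Definition complex_dim (R : realType) (n : nat) (P : 'M[R[i]]_n)
    (C : set (set 'M[R[i]]_n)) (d : nat) : Prop :=
  krull_dim (zariski_closed_flag P) C d.

Definition ordered_partitions (n : nat) : set (seq nat) :=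
  [set c | all (fun m => 0 < m)%N c /\ sumn c = n].

Definition one_line (n : nat) (s : 'S_n) : seq nat :=
  [seq (s i : nat) | i <- enum 'I_n].

(* The one-line notation obtained by cutting 0 1 ... n-1 into consecutive blocks
   of lengths c_1, ..., c_k and reversing every block: the permutation matrix is
   block diagonal, with antidiagonal blocks of sizes c_1, ..., c_k. *)
Definition block_reversal (n : nat) (c : seq nat) : seq nat :=
  flatten [seq rev b | b <- reshape c (iota 0 n)].

(* Main.v *)
Require Import Defs.
From mathcomp Require Import zify ring.

(* Work in the basis P, where N is the shift matrix J, let w be the permutation
   matrix of s, and write a flag of the Schubert cell as b w B with b upper
   triangular.  The matrix M = b^-1 J b is strictly upper triangular with nonzero
   superdiagonal, and the Hessenberg condition on b w says M (s i) (s j) = 0 for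
   i > j + 1.  The superdiagonal entries give s^-1 i <= s^-1 (i + 1) + 1, and the
   permutations with this property are the block reversals.  For such an s the
   condition only concerns the diagonal blocks of M, which must be
   superdiagonal; equivalently b w B = u w B for a block diagonal u with
   unitriangular Toeplitz blocks, and any such u occurs.  The n - k free entries
   of u are ratios of matrix entries of any representative of the flag, so the
   cell is homeomorphic to affine space of dimension n - k.

   The Krull dimension of affine m-space is at most m because equations cutting
   out a strict chain of r irreducible closed sets are algebraically independent:
   their monomials with exponents below D are D^r linearly independent
   polynomials of degree O(D), which is impossible for r > m and D large. *)

Set Implicit Arguments.
Unset Strict Implicit.
Unset Printing Implicit Defensive.

(** * Block reversals *)

(* Past the end [sumn c] both functions are the identity, so that their
   properties hold for all indices. *)
Fixpoint block_rev (c : seq nat) (i : nat) : nat :=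
  if c is m :: c' then
    if (i < m)%N then (m.-1 - i)%N else (m + block_rev c' (i - m))%N
  else i.

Fixpoint block_start (c : seq nat) (i : nat) : nat :=
  if c is m :: c' then
    if (i < m)%N then 0%N else (m + block_start c' (i - m))%N
  else i.

Lemma block_revK (c : seq nat) : involutive (block_rev c).
Proof.
elim: c => [//|m c IH] i /=; case: (ltnP i m) => h; case: ltnP => h'; try lia.
by rewrite addKn IH subnKC.
Qed.

Lemma block_start_rev (c : seq nat) (i : nat) :
  block_start c (block_rev c i) = block_start c i.
Proof.
elim: c i => [//|m c IH] i /=; case: (ltnP i m) => h; case: ltnP => h'; try lia.
by rewrite addKn IH.
Qed.

Lemma block_start_le (c : seq nat) (i : nat) : (block_start c i <= i)%N.
Proof. by elim: c i => [//|m c IH] i /=; case: (ltnP i m) => h //; have := IH (i - m)%N; lia. Qed.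

Lemma block_startK (c : seq nat) (i : nat) :
  block_start c (block_start c i) = block_start c i.
Proof.
elim: c i => [//|m c IH] i /=; case: (ltnP i m) => h; case: ltnP => h' //; try lia.
by rewrite addKn IH.
Qed.

Lemma block_start_mono (c : seq nat) (i j : nat) :
  (i <= j)%N -> (block_start c i <= block_start c j)%N.
Proof.
elim: c i j => [//|m c IH] i j lij /=; case: (ltnP i m) => h; case: (ltnP j m) => h' //; try lia.
by rewrite leq_add2l; apply: IH; lia.
Qed.

Lemma block_start_between (c : seq nat) (i k : nat) :
  (block_start c i <= k)%N -> (k <= i)%N -> block_start c k = block_start c i.
Proof.
move=> /(block_start_mono c); rewrite block_startK => h1 /(block_start_mono c) h2.
lia.
Qed.

(** Reversing a block of length m that starts at p sends i to 2p + m - 1 - i, so the sum depends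
    only on the block. *)
Lemma addn_block_rev (c : seq nat) (i j : nat) :
  block_start c i = block_start c j -> (i + block_rev c i = j + block_rev c j)%N.
Proof.
elim: c i j => [/= i j ->//|m c IH] i j /=; case: (ltnP i m) => h; case: (ltnP j m) => h'; try lia.
by move=> /addnI /IH; lia.
Qed.

Lemma block_rev_ltn (c : seq nat) (i : nat) :
  (i < sumn c)%N -> (block_rev c i < sumn c)%N.
Proof.
elim: c i => [//|m c IH] i /= h; case: (ltnP i m) => h'; first by lia.
by rewrite ltn_add2l IH //; lia.
Qed.

(** The hypothesis puts [i] in an earlier block than [j], and reversal keeps every index in its
    block. *)
Lemma ltn_block_start_rev (c : seq nat) (i j : nat) :
  (i < block_start c j)%N -> (block_rev c i < block_start c j)%N.
Proof.
move=> h; rewrite ltnNge; apply/negP => /(block_start_mono c).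
rewrite block_start_rev block_startK => h'.
by have := block_start_le c i; lia.
Qed.

(** Every block is nonempty and contributes exactly its first index; the remaining indices will
    carry the free parameters of a cell. *)
Lemma count_block_start (c : seq nat) : all (ltn 0) c ->
  count (fun i => block_start c i == i) (iota 0 (sumn c)) = size c.
Proof.
elim: c => [//|m c IH] /andP[/= m0 /IH {}IH].
rewrite iotaD count_cat add0n -[X in iota X (sumn c)]addn0 iotaDl count_map.
rewrite -[in RHS]IH -add1n.
congr addn; last first.
  by apply: eq_count => i /=; rewrite ltnNge leq_addr /= addKn eqn_add2l.
rewrite (@eq_in_count _ _ (pred1 0%N)) => [|i].
  by rewrite count_uniq_mem ?iota_uniq // mem_iota m0.
by rewrite mem_iota /= => ->; rewrite eq_sym.
Qed.

(** The value at 0 is one less than the first part, so that part can be read off and removed. *)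
Lemma block_rev_inj (c d : seq nat) :
  all (ltn 0) c -> all (ltn 0) d -> sumn c = sumn d ->
  (forall i, (i < sumn c)%N -> block_rev c i = block_rev d i) -> c = d.
Proof.
elim: c d => [|m c IH] [|k d] //=; try by lia.
move=> /andP[m0 hc] /andP[k0 hd] hs heq.
have mk : m = k by have := heq 0%N; rewrite m0 k0; lia.
subst k; congr cons; apply: IH => //; first lia.
move=> i hi; have := heq (m + i)%N.
rewrite (_ : (m + i < m)%N = false) ?addKn; last lia.
by rewrite ltn_add2l hi => /(_ isT)/addnI.
Qed.

(** Here [s] is the inverse of [t], and [t] never drops by more than one. With m = t 0, the values
    m, m - 1, ..., 0 must come first and in this order; they form a reversed block of length m + 1,
    and induction treats the rest. *)
Lemma block_rev_exists (n : nat) (t s : nat -> nat) :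
  (forall i, (i < n)%N -> (t i < n)%N /\ s (t i) = i) ->
  (forall i, (i < n)%N -> (s i < n)%N /\ t (s i) = i) ->
  (forall i, (i.+1 < n)%N -> (t i <= (t i.+1).+1)%N) ->
  exists2 c : seq nat, all (ltn 0) c /\ sumn c = n &
    forall i, (i < n)%N -> t i = block_rev c i.
Proof.
have [k] := ubnP n; elim: k n t s => // k IH n t s nk ht hs desc.
have [->|n0] := posnP n; first by exists [::].
set m := t 0%N.
have mn : (m < n)%N by case: (ht 0%N n0).
have first_block a : (a <= m)%N -> t a = (m - a)%N.
  elim/ltn_ind: a => a IHa am.
  have [->|a0] := posnP a; first by rewrite subn0.
  have tpa : t a.-1 = (m - a).+1 by rewrite IHa; lia.
  have /ht[tan sta] : (a < n)%N by lia.
  have /ht[_ stpa] : (a.-1 < n)%N by lia.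
  have := desc a.-1; rewrite prednK // tpa => /(_ _) le_ta.
  case: (ltngtP (t a) (m - a)) => // [|gt_ta]; first by have := le_ta; lia.
  (* The value m - a is attained later than a; since descents have size one,
     every position between a and that one has a smaller value. *)
  have /hs[pn tp] : (m - a < n)%N by lia.
  set p := s (m - a)%N in pn tp.
  have ap : (a < p)%N.
    rewrite ltnNge leq_eqVlt; apply/negP => /orP[/eqP pa|pa].
      by move: tp; rewrite pa; lia.
    by have := IHa p pa; lia.
  have below d : (a <= p - d.+1)%N -> (t (p - d.+1) < m - a)%N.
    elim: d => [|d IHd] hd.
      (* Just before [p] the value is at most m - a + 1, but that value is taken at a - 1, and m - a
         is taken at [p]. *)
      have := desc (p - 1)%N; rewrite subn1 prednK; last lia.
      rewrite tp => /(_ pn) le1.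
      have /ht[_ st1] : (p.-1 < n)%N by lia.
      have : t p.-1 <> (m - a)%N by move=> e; rewrite e -/p in st1; lia.
      have : t p.-1 <> (m - a).+1 by move=> e; rewrite e -tpa stpa in st1; lia.
      lia.
    have /IHd lt1 : (a <= p - d.+1)%N by lia.
    have := desc (p - d.+2)%N; rewrite (_ : (p - d.+2).+1 = (p - d.+1)%N); last lia.
    move=> /(_ _) le1.
    have /ht[_ st1] : (p - d.+2 < n)%N by lia.
    have : t (p - d.+2) <> (m - a)%N by move=> e; rewrite e -/p in st1; lia.
    by have := le1; lia.
  have := below (p - a.+1)%N; rewrite (_ : (p - (p - a.+1).+1)%N = a); last lia.
  by move=> /(_ (leqnn a)); lia.
(* Indices beyond the first block stay beyond it. Reversal of that block is its own inverse, so one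
   statement serves both [t] and [s]. *)
have shift (f g : nat -> nat) : (forall i, (i < n)%N -> (f i < n)%N /\ g (f i) = i) ->
    (forall i, (i <= m)%N -> g i = (m - i)%N) ->
    forall i, (i < n - m.+1)%N -> (m < f (i + m.+1))%N /\ (f (i + m.+1) < n)%N.
  move=> hf hg i hi; have /hf[fn gf] : (i + m.+1 < n)%N by lia.
  by split => //; rewrite ltnNge; apply/negP => /hg; lia.
have s_first i : (i <= m)%N -> s i = (m - i)%N.
  move=> im; have /first_block tmi : (m - i <= m)%N by lia.
  have /ht[] : (m - i < n)%N by lia.
  by rewrite tmi subKn.
have t_shift := shift t s ht s_first.
have s_shift := shift s t hs first_block.
pose t' i := (t (i + m.+1) - m.+1)%N; pose s' i := (s (i + m.+1) - m.+1)%N.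
have [] := IH (n - m.+1)%N t' s'; first lia.
- move=> i hi; have [h1 h2] := t_shift i hi; rewrite /t' /s'; split; first lia.
  have /ht[_ st1] : (i + m.+1 < n)%N by lia.
  by rewrite subnK // st1; lia.
- move=> i hi; have [h1 h2] := s_shift i hi; rewrite /t' /s'; split; first lia.
  have /hs[_ ts1] : (i + m.+1 < n)%N by lia.
  by rewrite subnK // ts1; lia.
- by move=> i hi; rewrite /t'; have := desc (i + m.+1)%N; rewrite addSn; lia.
move=> c [pc sc] tc; exists (m.+1 :: c); first by rewrite /= sc pc; split => //; lia.
move=> i hi /=; case: ltnP => him; first exact: first_block.
have hi' : (i - m.+1 < n - m.+1)%N by lia.
by rewrite -tc // /t' subnK //; have := t_shift _ hi'; rewrite subnK //; lia.
Qed.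

Lemma nth_block_reversal (n : nat) (c : seq nat) (i : nat) :
  sumn c = n -> (i < n)%N -> nth 0%N (block_reversal n c) i = block_rev c i.
Proof.
rewrite /block_reversal => <-.
(* The start of [iota] becomes a variable, since the tail of [c] cuts a later interval. *)
suff: forall b, (i < sumn c)%N ->
    nth 0%N (flatten [seq rev x | x <- reshape c (iota b (sumn c))]) i = (b + block_rev c i)%N.
  by move=> /(_ 0%N).
elim: c i => [//|m c IH] i b /= hi.
rewrite take_iota drop_iota; rewrite (minn_idPl _) ?leq_addr // addKn nth_cat size_rev size_iota.
case: ltnP => h; first by rewrite nth_rev ?size_iota // nth_iota; lia.
by rewrite addnC IH ?addnA //; lia.
Qed.

Lemma size_block_reversal (n : nat) (c : seq nat) :
  sumn c = n -> size (block_reversal n c) = n.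
Proof.
move=> <-; rewrite /block_reversal size_flatten /shape -map_comp.
rewrite (eq_map (g := size)) => [|x /=]; last by rewrite size_rev.
by rewrite -/(shape _) reshapeKl // size_iota.
Qed.

Import GRing.Theory Num.Theory.
Local Open Scope classical_set_scope.
Local Open Scope card_scope.
Local Open Scope ring_scope.

(** * Krull dimension of affine space *)

Lemma krull_dim_uniq (T : Type) (closed : set (set T)) (Y : set T) (d e : nat) :
  krull_dim closed Y d -> krull_dim closed Y e -> d = e.
Proof.
move=> [cd maxd] [ce maxe]; apply/eqP.
by rewrite eqn_leq maxe // maxd.
Qed.

(** The hypotheses make [phi] a homeomorphism onto its range with the subspace topology, so chains
    transfer by images one way and by preimages the other way. *)
Lemma krull_dim_homeo (X T : Type) (closedX : set (set X)) (closedT : set (set T))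
    (phi : X -> T) (d : nat) : injective phi ->
  (forall F, closedT F -> closedX (phi @^-1` F)) ->
  (forall G, closedX G -> exists2 F, closedT F & phi @^-1` F = G) ->
  krull_dim closedX setT d -> krull_dim closedT (range phi) d.
Proof.
move=> phi_inj phi_cont phi_closed [chain_d max_d].
have preim_image G : phi @^-1` (phi @` G) = G.
  by apply/seteqP; split => [x [y Gy /phi_inj <-]|x Gx] //; exists x.
split.
  have [Z [hZ ltZ]] := chain_d; exists (fun i => phi @` Z i); split => [i /hZ|i /ltZ].
    move=> [[G cG ->]]; rewrite setIT => -[[x Gx] irrG]; split.
      have [F cF FG] := phi_closed _ cG; exists F => //.
      apply/seteqP; split => [_ [y Gy <-]|y [Fy [z _ zy]]].
        by split; [rewrite -FG in Gy | exists y].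
      by exists z => //; rewrite -FG /preimage /= zy.
    split; first by exists (phi x), x.
    move=> F1 F2 cF1 cF2 GF.
    case: (irrG _ _ (phi_cont _ cF1) (phi_cont _ cF2)) => [y Gy|h|h].
    - by apply: GF; exists y.
    - by left => _ [y /h Gy <-].
    - by right => _ [y /h Gy <-].
  rewrite !properEneq => -[neZ leZ]; split; last exact: image_subset.
  by apply: contra neZ => /eqP e; rewrite -[Z i]preim_image e preim_image.
move=> r [Z [hZ ltZ]]; apply: max_d; exists (fun i => phi @^-1` Z i).
have ZE i : (i <= r)%N -> Z i = phi @` (phi @^-1` Z i).
  move=> /hZ[[F _ ZF] _]; rewrite ZF; apply/seteqP.
  split => [y [Fy [x _ xy]]|_ [x Zx <-]] //.
  by exists x => //; split; [rewrite xy | exists x].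
split => [i ir|i ir].
  have [[F cF ZF] [[y Zy] irrZ]] := hZ i ir; split.
    exists (phi @^-1` F); first exact: phi_cont.
    by rewrite ZF; apply/seteqP; split => x; [move=> [Fx _] | move=> [Fx _]; split=> //; exists x].
  split; first by move: Zy; rewrite {1}ZE // => -[x Zx _]; exists x.
  move=> G1 G2 /phi_closed[F1 cF1 <-] /phi_closed[F2 cF2 <-] ZF12.
  case: (irrZ _ _ cF1 cF2) => [z|h|h].
  - by rewrite ZE // => -[x Zx <-]; apply: ZF12.
  - by left => x /h.
  - by right => x /h.
have := ltZ i ir; rewrite !properEneq => -[neZ leZ]; split; last by move=> x /leZ.
by apply: contra neZ => /eqP e; rewrite ZE 1?ltnW // e -ZE.
Qed.

Lemma mpoly_ring_ind (K : comNzRingType) (m : nat) (Q : {mpoly K[m]} -> Prop) :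
  (forall c, Q c%:MP) -> (forall i, Q 'X_i) ->
  (forall p q, Q p -> Q q -> Q (p + q)) ->
  (forall p q, Q p -> Q q -> Q (p * q)) -> forall p, Q p.
Proof.
move=> QC QX QD QM; elim/mpolyind => [|c k p _ _ Qp]; first by rewrite -mpolyC0.
apply: QD => //; rewrite -mul_mpolyC; apply: (QM); first exact: (QC).
rewrite mpolyXE_id; apply: (big_ind Q); [by rewrite -mpolyC1; apply: (QC)|exact: (QM)|move=> i _].
by elim: (k i) => [|e IH]; rewrite ?expr0 -?mpolyC1 ?exprS //; apply: (QM).
Qed.

Definition zariski_closed_affine (K : nzRingType) (m : nat) : set (set ('I_m -> K)) :=
  [set F | exists I : set {mpoly K[m]}, F = [set x | forall p, I p -> p.@[x] = 0]].

Lemma irreducible_mul_eq0 (K : idomainType) (m : nat) (Z : set ('I_m -> K))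
    (p q : {mpoly K[m]}) : irreducible_set (@zariski_closed_affine K m) Z ->
  (forall x, Z x -> p.@[x] * q.@[x] = 0) ->
  (forall x, Z x -> p.@[x] = 0) \/ (forall x, Z x -> q.@[x] = 0).
Proof.
move=> [_ irr] pq0.
have cl (u : {mpoly K[m]}) : zariski_closed_affine [set x | u.@[x] = 0].
  by exists [set u]; apply/seteqP; split => x /= => [ux _ ->|->].
have [x /pq0/eqP|h|h] := irr _ _ (cl p) (cl q); last 2 first.
- by left => x /h.
- by right => x /h.
by rewrite mulf_eq0 => /orP[]/eqP; [left|right].
Qed.

Lemma mnm_le_mdeg (m : nat) (k : 'X_{1..m}) (i : 'I_m) : (k i <= mdeg k)%N.
Proof. by rewrite mdegE (bigD1 i) //= leq_addr. Qed.

(** A monomial of degree below [b] has all its exponents below [b]; this crude count suffices for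
    comparing growth. *)
Lemma leq_card_bmultinom (m b : nat) : (#|{: 'X_{1..m < b}}| <= b ^ m)%N.
Proof.
pose f (k : 'X_{1..m < b}) : {ffun 'I_m -> 'I_b} :=
  [ffun i => Ordinal (leq_ltn_trans (mnm_le_mdeg k i) (bmdeg k))].
have /leq_card : injective f.
  move=> k l /ffunP kl; apply/val_inj/mnmP => i.
  by have := kl i; rewrite !ffunE => /(congr1 val).
by rewrite card_ffun !card_ord.
Qed.

(** The coefficient matrix has a row per polynomial and a column per monomial of degree below [b],
    hence more rows than columns; a nonzero vector of its left kernel is a relation. *)
Lemma mpoly_dependent (K : fieldType) (m b : nat) (I : finType)
    (L : I -> {mpoly K[m]}) :
  (forall a, (msize (L a) <= b)%N) -> (b ^ m < #|I|)%N ->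
  exists2 l : I -> K, \sum_a l a *: L a = 0 & exists a, l a != 0.
Proof.
move=> sizeL ltI.
pose A := \matrix_(i < #|I|, j < #|{: 'X_{1..m < b}}|) (L (enum_val i))@_(enum_val j).
have : kermx A != 0.
  rewrite kermx_eq0 /row_free; apply/negP => /eqP rA.
  have := leq_trans (rank_leq_col A) (leq_card_bmultinom m b).
  by rewrite rA leqNgt ltI.
have [i0 Ai0 _|ker0] := pickP (fun i => row i (kermx A) != 0); last first.
  by case/eqP; apply/row_matrixP => i; apply/eqP; rewrite row0; apply: negbFE (ker0 i).
have kA : row i0 (kermx A) *m A = 0 by rewrite -row_mul mulmx_ker row0.
have /rV0Pn[i1 i1n0] := Ai0.
exists (fun a => row i0 (kermx A) 0 (enum_rank a)); last first.
  by exists (enum_val i1); rewrite enum_valK.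
apply/mpolyP => k; rewrite mcoeff0 raddf_sum /=.
have [lt_kb|le_bk] := ltnP (mdeg k) b; last first.
  apply: big1 => a _; rewrite mcoeffZ memN_msupp_eq0 ?mulr0 //.
  exact/msize_mdeg_ge/(leq_trans (sizeL a)).
have /matrixP/(_ 0 (enum_rank (BMultinom lt_kb))) := kA.
rewrite mxE [RHS]mxE => kA0; rewrite -[RHS]kA0 (reindex enum_rank) /=; last first.
  by exists enum_val => i _; rewrite ?enum_valK ?enum_rankK.
by apply: eq_bigr => a _; rewrite mcoeffZ [A _ _]mxE !enum_rankK.
Qed.

Lemma msize_exprM_le (K : idomainType) (m e j : nat) (g p : {mpoly K[m]}) :
  (msize g <= e)%N -> (msize (g ^+ j * p) <= j * e.+1 + msize p)%N.
Proof.
move=> ge; elim: j => [|j IH]; first by rewrite expr0 mul1r.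
by rewrite exprS -mulrA; apply: leq_trans (msizeM_le _ _) _; rewrite mulSn; lia.
Qed.

(* Equations g i of Z i that do not vanish on Z i.+1 are algebraically
   independent: in a vanishing combination of their monomials, the terms free of
   the last equation vanish on the smaller set, and a common factor g i can be
   cancelled by irreducibility. *)
Lemma chain_independent (K : fieldType) (m r D e : nat)
    (Z : nat -> set ('I_m -> K)) (g : nat -> {mpoly K[m]}) :
  (forall i, (i <= r)%N -> irreducible_set (@zariski_closed_affine K m) (Z i)) ->
  (forall i, (i < r)%N -> Z i `<=` Z i.+1 /\
    (forall x, Z i x -> (g i).@[x] = 0) /\ exists2 x, Z i.+1 x & (g i).@[x] != 0) ->
  (forall i, (i < r)%N -> (msize (g i) <= e)%N) ->
  exists (I : finType) (L : I -> {mpoly K[m]}),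
    [/\ #|I| = (D ^ r)%N, forall a, (msize (L a) <= r * (D * e.+1) + 1)%N &
     forall l : I -> K, (forall x, Z r x -> \sum_a l a * (L a).@[x] = 0) ->
       forall a, l a = 0].
Proof.
elim: r => [|r IH] irrZ hg sizeg.
  exists 'I_1, (fun _ => 1); split => [|_|l lZ a]; rewrite ?card_ord ?msize1 ?ord1 //.
  have [[x Zx] _] := irrZ 0%N isT.
  by have := lZ x Zx; rewrite big_ord1 meval1 mulr1.
have [|||I [L [cardI sizeL indL]]] := IH.
- by move=> i ir; apply: irrZ; lia.
- by move=> i ir; apply: hg; lia.
- by move=> i ir; apply: sizeg; lia.
have [//|subZ [g0 [x0 Zx0 gx0]]] := hg r.
exists ('I_D * I)%type, (fun a : 'I_D * I => g r ^+ a.1 * L a.2); split => [|[j a] /=|l lZ [j0 a0]].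
- by rewrite card_prod card_ord cardI expnS.
- apply: leq_trans (msize_exprM_le j (L a) (sizeg r (ltnSn r))) _.
  by rewrite mulSn -addnA leq_add // leq_mul2r ltnW ?orbT.
(* Induction runs on the number [E] of powers of [g r], so the coefficients are indexed by [nat],
   with value 0 from [D] on. *)
suff ind E (c : nat -> I -> K) : (forall x, Z r.+1 x ->
    \sum_(j < E) (g r).@[x] ^+ j * \sum_a c j a * (L a).@[x] = 0) ->
    forall j a, (j < E)%N -> c j a = 0.
  pose c k a := if insub k is Some j then l (j, a) else 0.
  have cE (j : 'I_D) a : c j a = l (j, a) by rewrite /c valK.
  rewrite -cE; apply: (ind D) => // x Zx; rewrite -[RHS](lZ x Zx).
  rewrite [RHS](eq_bigr (fun p => l (p.1, p.2) * ((g r).@[x] ^+ p.1 * (L p.2).@[x]))).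
    rewrite -(pair_bigA _ (fun j a => l (j, a) * ((g r).@[x] ^+ j * (L a).@[x]))) /=.
    apply: eq_bigr => j _; rewrite mulr_sumr; apply: eq_bigr => a _.
    by rewrite cE mulrCA.
  by move=> [j a] _ /=; rewrite mevalM rmorphXn.
elim: E c => [//|E IHE] c cZ.
(* On [Z r] every term with a positive power of [g r] vanishes. *)
have c0 a : c 0%N a = 0.
  apply: indL => x Zx; have := cZ x (subZ _ Zx).
  rewrite big_ord_recl expr0 mul1r [X in _ + X]big1 ?addr0 // => j _.
  by rewrite g0 // exprS mul0r mul0r.
have cS j a : (j < E)%N -> c j.+1 a = 0.
  apply: (IHE (fun j => c j.+1)).
  pose h : {mpoly K[m]} := \sum_(j < E) g r ^+ j * \sum_a c j.+1 a *: L a.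
  have hE x : h.@[x] = \sum_(j < E) (g r).@[x] ^+ j * \sum_a c j.+1 a * (L a).@[x].
    rewrite raddf_sum /=; apply: eq_bigr => k _; rewrite mevalM rmorphXn /=; congr (_ * _).
    by rewrite raddf_sum /=; apply: eq_bigr => b _; rewrite mevalZ.
  have [x Zx|gZ|hZ] := irreducible_mul_eq0 (p := g r) (q := h) (irrZ r.+1 (leqnn _)).
  - rewrite -[RHS](cZ x Zx) big_ord_recl [X in _ * X + _]big1 => [|b _]; last by rewrite c0 mul0r.
    rewrite mulr0 add0r hE mulr_sumr; apply: eq_bigr => k _.
    by rewrite mulrA -exprS.
  - by rewrite gZ ?eqxx in gx0.
  - by move=> x Zx; rewrite -hE hZ.
by move=> [|j] a; [rewrite c0 | exact: cS].
Qed.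

Lemma irreducible_chain_affine_le (K : fieldType) (m r : nat) :
  irreducible_chain (@zariski_closed_affine K m) setT r -> (r <= m)%N.
Proof.
move=> [Z [hZ ltZ]].
(* Take an equation of [Z i] that fails somewhere on [Z i.+1]; beyond the chain the value 0 makes
   the choice total. *)
have : forall i, exists g : {mpoly K[m]}, (i < r)%N -> Z i `<=` Z i.+1 /\
    (forall x, Z i x -> g.@[x] = 0) /\ exists2 x, Z i.+1 x & g.@[x] != 0.
  move=> i; have [ir|ri] := ltnP i r; last by exists 0.
  have [F [I FE]] := (hZ i (ltnW ir)).1.
  rewrite setIT => ZF.
  have [subZ nsubZ] := ltZ i ir.
  have [x [Zx nZx]] : exists x, Z i.+1 x /\ ~ Z i x.
    by apply: contra_notP nsubZ => /forallNP h x Zx; apply: contra_notP (h x).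
  have [g [Ig gx]] : exists g, I g /\ g.@[x] <> 0.
    apply: contra_notP nZx => /forallNP h; rewrite ZF FE /= => p Ip.
    by apply: contra_notP (h p).
  exists g => _; split => //; split; last by exists x => //; apply/eqP.
  by move=> y; rewrite ZF FE => /(_ g Ig).
move=> /choice[g hg].
pose e := \max_(i < r) msize (g i).
have sizeg i : (i < r)%N -> (msize (g i) <= e)%N.
  by move=> ir; apply: (leq_bigmax (Ordinal ir)).
(* The D^r independent polynomials have size at most D B. Since D > B^m, r > m would give (D B)^m <
   D^(m+1) <= D^r, hence a linear relation. *)
pose B := (r * e.+1 + 1)%N; pose D := (B ^ m + 1)%N.
have [I [L [cardI sizeL indL]]] :=
  @chain_independent K m r D e Z g (fun i ir => (hZ i ir).2) hg sizeg.
rewrite leqNgt; apply/negP => mr.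
have [||l lL [a]] := @mpoly_dependent K m (D * B) I L.
- by move=> a; apply: leq_trans (sizeL a) _; rewrite /B /D; nia.
- rewrite cardI expnMn; apply: (@leq_trans (D ^ m.+1)); last by rewrite leq_exp2l // /D; lia.
  by rewrite expnSr ltn_pmul2l ?expn_gt0 /D; lia.
rewrite indL ?eqxx // => x _.
transitivity ((\sum_a l a *: L a).@[x]); last by rewrite lL meval0.
by rewrite raddf_sum /=; apply: eq_bigr => b _; rewrite mevalZ.
Qed.

Lemma poly_all_roots_eq0 (K : numFieldType) (p : {poly K}) :
  (forall x, p.[x] = 0) -> p = 0.
Proof.
move=> p0; apply/eqP; apply: contraT => pn0.
have := @max_poly_roots _ p [seq k%:R | k <- iota 0 (size p)] pn0.
rewrite size_map size_iota ltnn => -> //; first by apply/allP => x _; apply/eqP.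
by rewrite map_inj_uniq ?iota_uniq // => i j /eqP; rewrite eqr_nat => /eqP.
Qed.

Lemma meval_line (K : comNzRingType) (m : nat) (p : {mpoly K[m]}) (x y : 'I_m -> K) :
  exists P : {poly K}, forall t, P.[t] = p.@[fun i => x i + t * (y i - x i)].
Proof.
elim/mpoly_ring_ind: p => [c|i|p q [P hP] [Q hQ]|p q [P hP] [Q hQ]].
- by exists c%:P => t; rewrite hornerC mevalC.
- exists ((x i)%:P + (y i - x i) *: 'X) => t.
  by rewrite mevalXU !hornerE mulrC.
- by exists (P + Q) => t; rewrite hornerD mevalD hP hQ.
- by exists (P * Q) => t; rewrite hornerM mevalM hP hQ.
Qed.

(** The chain consists of coordinate subspaces. One of them is irreducible because, if p(x) and q(y)
    are nonzero at two of its points, the product p q restricted to the line through x and y is a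
    nonzero polynomial in one variable, and K is infinite. *)
Lemma irreducible_chain_affine (K : numFieldType) (m : nat) :
  irreducible_chain (@zariski_closed_affine K m) setT m.
Proof.
exists (fun k => [set x | forall i : 'I_m, (k <= i)%N -> x i = 0]).
split => [k km|k km]; last first.
  split => [x xk i ki|]; first by apply: xk; apply: ltnW.
  move=> /(_ (fun i => (i == Ordinal km)%:R)) h.
  have /h/(_ (Ordinal km) (leqnn k))/eqP : forall i : 'I_m,
      (k.+1 <= i)%N -> (i == Ordinal km)%:R = 0 :> K.
    by move=> i ki; rewrite -val_eqE /= gtn_eqF.
  by rewrite eqxx oner_eq0.
set Z : set ('I_m -> K) := (X in closed_in _ _ X); split; last split.
- exists Z; last by rewrite setIT.
  exists [set p | exists2 i : 'I_m, (k <= i)%N & p = 'X_i].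
  apply/seteqP; split => [x xk _ [i ki ->]|x xk i ki]; first by rewrite mevalXU xk.
  by rewrite -(mevalXU x) xk //; exists i.
- by exists (fun=> 0).
move=> F1 F2 [I1 ->] [I2 ->] cov; apply: contrapT => /not_orP[].
move=> /existsNP[x /not_implyP[Zx /existsNP[p /not_implyP[I1p px]]]].
move=> /existsNP[y /not_implyP[Zy /existsNP[q /not_implyP[I2q qy]]]].
have [P hP] := meval_line p x y; have [Q hQ] := meval_line q x y.
have /eqP : P * Q = 0.
  apply: poly_all_roots_eq0 => t; rewrite hornerM hP hQ.
  have /cov[/(_ p I1p) ->|/(_ q I2q) ->] : Z (fun i => x i + t * (y i - x i)).
  - by move=> i ki; rewrite Zx ?Zy // subrr mulr0 addr0.
  - by rewrite mul0r.
  - by rewrite mulr0.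
rewrite mulf_eq0 => /orP[]/eqP h; rewrite h in hP hQ.
  by apply: px; have := hP 0; rewrite horner0 => ->; apply: meval_eq => i; rewrite mul0r addr0.
by apply: qy; have := hQ 1; rewrite horner0 => ->; apply: meval_eq => i; rewrite mul1r addrC subrK.
Qed.

Lemma krull_dim_affine (K : numFieldType) (m : nat) :
  krull_dim (@zariski_closed_affine K m) setT m.
Proof.
split; first exact: irreducible_chain_affine.
exact: irreducible_chain_affine_le.
Qed.

(** * Flags in the Jordan basis *)

Lemma mulmx_eq_single (K : pzRingType) (m n p : nat) (A : 'M[K]_(m, n))
    (B : 'M[K]_(n, p)) (i : 'I_m) (j : 'I_p) (k : 'I_n) :
  (forall l, A i l != 0 -> B l j != 0 -> l = k) -> (A *m B) i j = A i k * B k j.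
Proof.
move=> h; rewrite mxE (bigD1 k) //= big1 ?addr0 // => l.
have [->|Al] := eqVneq (A i l) 0; first by rewrite mul0r.
have [->|Bl] := eqVneq (B l j) 0; first by rewrite mulr0.
by rewrite (h l) ?eqxx.
Qed.

Lemma mulmx_support (K : pzRingType) (m n p : nat) (A : 'M[K]_(m, n))
    (B : 'M[K]_(n, p)) (i : 'I_m) (j : 'I_p) :
  (A *m B) i j != 0 -> exists2 l, A i l != 0 & B l j != 0.
Proof.
apply: contraNP => /forall2NP h; rewrite mxE big1 // => l _.
by have [/negP|/negP] := h l; rewrite negbK => /eqP ->; rewrite ?mul0r ?mulr0.
Qed.

(** Phrased through nonzero entries, triangularity combines directly with [mulmx_support]. *)
Definition upper_mx (K : nmodType) (n : nat) (A : 'M[K]_n) : Prop :=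
  forall i j : 'I_n, A i j != 0 -> (i <= j)%N.

Lemma upper_mxM (K : pzRingType) (n : nat) (A B : 'M[K]_n) :
  upper_mx A -> upper_mx B -> upper_mx (A *m B).
Proof. by move=> hA hB i j /mulmx_support[l /hA il /hB]; apply: leq_trans. Qed.

Lemma upper_mx1 (K : pzRingType) (n : nat) : upper_mx (1%:M : 'M[K]_n).
Proof. by move=> i j; rewrite mxE; case: (eqVneq i j) => [->|_] //; rewrite mulr0n eqxx. Qed.

Lemma upper_mx_trig (K : nmodType) (n : nat) (A : 'M[K]_n) :
  upper_mx A <-> is_trig_mx A^T.
Proof.
split=> [h|/is_trig_mxP h i j].
  apply/is_trig_mxP => i j ij; rewrite mxE; apply: contraTeq ij => /h.
  by rewrite -leqNgt.
by apply: contraNT; rewrite -ltnNge => /h; rewrite mxE => ->.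
Qed.

Lemma upper_mx_unit (K : fieldType) (n : nat) (A : 'M[K]_n) :
  upper_mx A -> (A \in unitmx) = [forall i, A i i != 0].
Proof.
move=> /upper_mx_trig trA; rewrite -unitmx_tr unitmxE det_trig // unitfE.
rewrite (eq_bigr (fun i => A i i)) => [|i _]; last by rewrite mxE.
by apply/prodf_neq0/forallP => h i //; apply: h.
Qed.

Lemma upper_mx_diag (K : fieldType) (n : nat) (A : 'M[K]_n) (i : 'I_n) :
  upper_mx A -> A \in unitmx -> A i i != 0.
Proof. by move=> /upper_mx_unit -> /forallP. Qed.

(** Induction from the bottom row upwards: below the diagonal, once the lower rows are known, the
    entry of [A *m invmx A] reduces to a nonzero diagonal entry times the wanted one. *)
Lemma upper_mxV (K : fieldType) (n : nat) (A : 'M[K]_n) :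
  upper_mx A -> A \in unitmx -> upper_mx (invmx A).
Proof.
move=> hA uA i j; have [d] := ubnP (n - i)%N; elim: d i => // d IH i id.
apply: contraNT; rewrite -ltnNge => ji.
have := mulmxV uA => /matrixP/(_ i j); rewrite (@mulmx_eq_single _ _ _ _ _ _ i j i).
  rewrite [RHS]mxE -val_eqE /= gtn_eqF // => /eqP; rewrite mulf_eq0.
  by rewrite (negPf (upper_mx_diag i hA uA)).
move=> l /hA; rewrite leq_eqVlt => /orP[/eqP il _|il Bl]; first exact/val_inj.
have /IH/(_ Bl) : (n - l < d)%N by have := ltn_ord l; lia.
by lia.
Qed.

Definition shift_mx (K : pzSemiRingType) (n : nat) : 'M[K]_n :=
  \matrix_(i, j) (i.+1 == j :> nat)%:R.

Lemma shift_mxM (K : pzRingType) (n : nat) (A : 'M[K]_n) (i i' j : 'I_n) :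
  i' = i.+1 :> nat -> (shift_mx K n *m A) i j = A i' j.
Proof.
move=> i'E; rewrite (@mulmx_eq_single _ _ _ _ _ _ _ _ i'); first by rewrite mxE i'E eqxx mul1r.
move=> l; rewrite mxE => h _; apply/val_inj; move: h => /=.
by case: (i.+1 =P l) => [<-|]; rewrite ?i'E // eqxx.
Qed.

(** [M] is the shift conjugated by [b]. At position (i, i + 1) both sides of the relation have a
    single term, so the superdiagonal of [M] has no zero. *)
Lemma shift_conj_upper (K : fieldType) (n : nat) (b M : 'M[K]_n) :
  upper_mx b -> b \in unitmx -> shift_mx K n *m b = b *m M ->
  (forall i j : 'I_n, M i j != 0 -> (i < j)%N) /\
  (forall i j : 'I_n, j = i.+1 :> nat -> b j j = b i i * M i j).
Proof.
move=> hb ub bM.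
have strict (i j : 'I_n) : M i j != 0 -> (i < j)%N.
  have -> : M = invmx b *m (shift_mx K n *m b) by rewrite bM mulKmx.
  move=> /mulmx_support[l /(upper_mxV hb ub) il /mulmx_support[k]].
  by rewrite mxE => + /hb; case: (l.+1 =P k) => [<-|]; rewrite ?eqxx //; lia.
split=> // i j ji; rewrite -(shift_mxM b j ji) bM; apply: mulmx_eq_single.
by move=> l /hb il /strict; rewrite ji => li; apply/val_inj => /=; lia.
Qed.

(** * Block Toeplitz representatives of flags *)

Definition block_start_ord (n : nat) (c : seq nat) (i : 'I_n) : 'I_n :=
  Ordinal (leq_ltn_trans (block_start_le c i) (ltn_ord i)).

(* Block diagonal, and in the block starting at p the d-th superdiagonal has the
   constant value t (p + d). *)
Definition toeplitz_mx (K : nmodType) (n : nat) (c : seq nat) (t : nat -> K) : 'M[K]_n :=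
  \matrix_(i, j) if (block_start c i == block_start c j) && (i <= j)%N
                 then t (block_start c i + (j - i))%N else 0.

Lemma toeplitz_support (K : nmodType) (n : nat) (c : seq nat) (t : nat -> K) (i j : 'I_n) :
  toeplitz_mx n c t i j != 0 -> block_start c i = block_start c j /\ (i <= j)%N.
Proof. by rewrite mxE; case: andP => [[/eqP]|]; rewrite ?eqxx. Qed.

Lemma toeplitz_upper (K : nmodType) (n : nat) (c : seq nat) (t : nat -> K) :
  upper_mx (toeplitz_mx n c t).
Proof. by move=> i j /toeplitz_support[]. Qed.

(** The value at a block start is the diagonal constant of the block, so [toeplitz_mx] becomes
    unitriangular. *)
Definition start_normalized (K : nzSemiRingType) (c : seq nat) (t : nat -> K) : Prop :=
  forall i, block_start c i = i -> t i = 1.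

Lemma toeplitz_unit (K : fieldType) (n : nat) (c : seq nat) (t : nat -> K) :
  start_normalized c t -> toeplitz_mx n c t \in unitmx.
Proof.
move=> ht; rewrite upper_mx_unit; last exact: toeplitz_upper.
by apply/forallP => i; rewrite mxE eqxx leqnn subnn addn0 ht ?oner_eq0 ?block_startK.
Qed.

Lemma mulmx_tr_perm (K : pzRingType) (n : nat) (A : 'M[K]_n) (s : 'S_n) (i j : 'I_n) :
  (A *m (perm_mx s)^T) i j = A i (s j).
Proof. by rewrite tr_perm_mx -col_permE mxE. Qed.

Definition reverses (n : nat) (c : seq nat) (s : 'S_n) : Prop :=
  forall i : 'I_n, s i = block_rev c i :> nat.

Lemma reversesK (n : nat) (c : seq nat) (s : 'S_n) : reverses c s -> involutive s.
Proof. by move=> hs i; apply/val_inj; rewrite /= !hs block_revK. Qed.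

(* In the rows below p the first p columns of u w b vanish, so that column p is
   there a multiple of a column of u. *)
Lemma toeplitz_schubert_entry (K : fieldType) (n : nat) (c : seq nat) (s : 'S_n)
    (t : nat -> K) (b : 'M[K]_n) (i : 'I_n) : reverses c s -> upper_mx b ->
  let p := block_start_ord c i in
  (toeplitz_mx n c t *m (perm_mx s)^T *m b) (s i) p = t i * b p p.
Proof.
move=> hs hb p; rewrite (@mulmx_eq_single _ _ _ _ _ _ _ _ p) => [|l].
  rewrite mulmx_tr_perm mxE !hs !block_start_rev block_startK eqxx /=.
  have /= irev := addn_block_rev (esym (block_startK c i)).
  have ip := block_start_le c i; rewrite (_ : (_ <= _)%N); last lia.
  by congr (t _ * _); lia.
rewrite mulmx_tr_perm => /toeplitz_support[]; rewrite !hs !block_start_rev => si _ /hb lp.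
by apply/val_inj; move: lp; have := block_start_le c l; rewrite -si /=; lia.
Qed.

(** [M (s i) (s j)] is the entry (i, j) of [M] conjugated by the permutation matrix, so this is the
    Hessenberg condition on that conjugate. *)
Definition perm_hessenberg (K : nmodType) (n : nat) (s : 'S_n) (M : 'M[K]_n) : Prop :=
  forall i j : 'I_n, M (s i) (s j) != 0 -> (i <= j.+1)%N.

(** The Toeplitz matrix [u] commutes with the block diagonal part [J] of the shift. The rest [E]
    links consecutive blocks, and its conjugate by [u] stays strictly above the diagonal blocks. *)
Lemma toeplitz_hessenberg (K : fieldType) (n : nat) (c : seq nat) (s : 'S_n)
    (t : nat -> K) : reverses c s -> start_normalized c t ->
  exists2 M, shift_mx K n *m toeplitz_mx n c t = toeplitz_mx n c t *m M &
    perm_hessenberg s M.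
Proof.
move=> hs ht; set u := toeplitz_mx n c t.
have uu : u \in unitmx by apply: toeplitz_unit.
pose J : 'M[K]_n :=
  \matrix_(i, j) ((i.+1 == j :> nat) && (block_start c i == block_start c j))%:R.
have JP i j : J i j != 0 -> i.+1 = j /\ block_start c i = block_start c j.
  by rewrite mxE; case: andP => [[/eqP ? /eqP ?]|]; rewrite ?eqxx.
pose E := shift_mx K n - J.
have EP i j : E i j != 0 -> (i < block_start c j)%N.
  rewrite !mxE; case: (i.+1 =P j) => [ij|_]; last by rewrite subrr eqxx.
  case: (_ =P block_start c j) => [_|ne _]; first by rewrite subrr eqxx.
  rewrite ltnNge; apply/negP => /block_start_between h; apply: ne.
  by apply: h; rewrite -ij.
have Ju : J *m u = u *m J.
  have val_in (i j k : 'I_n) : block_start c i = block_start c j -> (i < j)%N ->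
      (i <= k <= j)%N -> block_start c k = block_start c j.
    move=> sij ij /andP[ik kj]; apply: block_start_between kj.
    by rewrite -sij; apply: leq_trans ik; apply: block_start_le.
  apply/matrixP => i j.
  have [/andP[/eqP sij ij]|ncond] := boolP ((block_start c i == block_start c j) && (i < j)%N).
    have i1n : (i.+1 < n)%N by apply: leq_ltn_trans (ltn_ord j).
    have j1n : (j.-1 < n)%N by have := ltn_ord j; lia.
    have si1 : block_start c i.+1 = block_start c j.
      by apply: (val_in i j (Ordinal i1n)) => //=; lia.
    have sj1 : block_start c j.-1 = block_start c j.
      by apply: (val_in i j (Ordinal j1n)) => //=; lia.
    rewrite (@mulmx_eq_single _ _ _ _ _ _ _ _ (Ordinal i1n)); last first.
      by move=> l /JP[il _] _; apply/val_inj; rewrite /= il.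
    rewrite (@mulmx_eq_single _ _ _ _ _ _ _ _ (Ordinal j1n)); last first.
      by move=> l _ /JP[lj _]; apply/val_inj; rewrite /= -lj.
    rewrite !mxE /= !si1 !sj1 sij !eqxx prednK ?eqxx /=; last lia.
    have ij1 : (i <= j.-1)%N by lia.
    rewrite ij ij1 mul1r mulr1.
    by congr (t _); lia.
  transitivity (0 : K); [|symmetry]; apply/eqP; apply: contraNT ncond => /mulmx_support[l].
    by move=> /JP[il ->] /toeplitz_support[-> lj]; rewrite eqxx il.
  by move=> /toeplitz_support[-> il] /JP[lj ->]; rewrite eqxx -lj ltnS.
exists (J + invmx u *m (E *m u)).
  by rewrite mulmxDr -Ju mulKVmx // -mulmxDl addrC subrK.
move=> i j; rewrite mxE.
(* An entry outside the blocks stays above the diagonal under [s]; one coming from [J] is moved to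
   the subdiagonal, where i = j + 1. *)
have [-> |Jn0 _] := eqVneq (J (s i) (s j)) 0.
  rewrite add0r => /mulmx_support[l /(upper_mxV (@toeplitz_upper _ _ _ _) uu) il].
  move=> /mulmx_support[k /EP lk /toeplitz_support[skj _]].
  have : (s i < block_start c j)%N by rewrite -(block_start_rev c j) -hs -skj; lia.
  rewrite hs => /ltn_block_start_rev; rewrite block_revK => h.
  by have := block_start_le c j; lia.
have := JP _ _ Jn0; rewrite !hs !block_start_rev => -[h /addn_block_rev].
by lia.
Qed.

(** The sequence [t] is read off the first row of each diagonal block of [b], after scaling every
    column by its diagonal entry; the Hessenberg condition forces the other rows of the block to
    follow. *)
Lemma hessenberg_toeplitz (K : fieldType) (n : nat) (c : seq nat) (s : 'S_n)
    (b M : 'M[K]_n) : reverses c s -> upper_mx b -> b \in unitmx ->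
  shift_mx K n *m b = b *m M -> perm_hessenberg s M ->
  exists2 t, start_normalized c t &
    exists d, [/\ upper_mx d, d \in unitmx &
      b *m (perm_mx s)^T = toeplitz_mx n c t *m (perm_mx s)^T *m d].
Proof.
move=> hs hb ub bM hM; have sK := reversesK hs.
have bn0 i := upper_mx_diag i hb ub.
have [strictM diagM] := shift_conj_upper hb ub bM.
pose t k := if insub k is Some i then b (block_start_ord c i) i / b i i else 1.
have tE (i : 'I_n) : t i = b (block_start_ord c i) i / b i i by rewrite /t valK.
have ht : start_normalized c t.
  move=> i hi; rewrite /t; case: insubP => // j _ ji.
  by rewrite (_ : block_start_ord c j = j) ?divff //; apply/val_inj; rewrite /= ji.
exists t => //; set u := toeplitz_mx n c t.
have uu : u \in unitmx by apply: toeplitz_unit.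
(* Within a block [M] has only superdiagonal entries, so row i - 1 of the relation expresses b i j
   through b (i - 1) (j - 1). *)
have bE (i j : 'I_n) : block_start c i = block_start c j -> (i <= j)%N ->
    b i j = t (block_start c i + (j - i))%N * b j j.
  have [d] := ubnP (i - block_start c i)%N; elim: d i j => // d IH i j id sij ij.
  have := block_start_le c i; rewrite leq_eqVlt => /orP[/eqP si|si].
    rewrite [X in (X + _)%N]si subnKC // tE mulfVK //; congr (b _ j).
    by apply/val_inj; rewrite /= -si.
  have i1n : (i.-1 < n)%N by have := ltn_ord i; lia.
  have j1n : (j.-1 < n)%N by have := ltn_ord j; lia.
  pose i1 := Ordinal i1n; pose j1 := Ordinal j1n.
  have si1 : block_start c i1 = block_start c i by apply: block_start_between => /=; lia.
  have sj1 : block_start c j1 = block_start c j by apply: block_start_between => /=; lia.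
  have ii1 : i = i1.+1 :> nat by rewrite /= prednK //; lia.
  have jj1 : j = j1.+1 :> nat by rewrite /= prednK //; lia.
  rewrite -(shift_mxM b j ii1) bM (@mulmx_eq_single _ _ _ _ _ _ _ _ j1); last first.
    move=> l /hb il Mn0; have lj := strictM _ _ Mn0.
    have /addn_block_rev slj : block_start c l = block_start c j.
      apply: block_start_between (ltnW lj); rewrite -sij -si1.
      by apply: leq_trans il; apply: block_start_le.
    have := hM (s l) (s j); rewrite !sK !hs => /(_ Mn0) h.
    by apply/val_inj => /=; lia.
  clearbody i1 j1; rewrite (diagM _ _ jj1) (IH i1 j1); [|lia|lia|lia].
  by rewrite -mulrA si1; congr (t _ * _) => /=; lia.
pose D : 'M[K]_n := diag_mx (\row_j b j j).
have uD i j : (u *m D) i j = u i j * b j j.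
  rewrite (@mulmx_eq_single _ _ _ _ _ _ _ _ j) => [|l _]; first by rewrite !mxE eqxx.
  by rewrite !mxE; case: (eqVneq l j) => // _; rewrite mulr0n eqxx.
(* By [bE], [b] and [u *m D] agree on the diagonal blocks. *)
have XP i j : (b - u *m D) i j != 0 -> (i < block_start c j)%N.
  rewrite 2!mxE uD => Xn0; have [ij|ji] := leqP i j.
    rewrite ltnNge; apply/negP => /block_start_between/(_ ij) sij.
    by move: Xn0; rewrite (bE i j) // /u mxE sij eqxx ij subrr eqxx.
  have bij : b i j = 0 by apply: contraTeq ji => /hb; rewrite -leqNgt.
  by move: Xn0; rewrite bij /u mxE andbC leqNgt ji mul0r subrr eqxx.
pose Y := invmx u *m (b - u *m D).
have YP i j : Y i j != 0 -> (i < block_start c j)%N.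
  by move=> /mulmx_support[l /(upper_mxV (@toeplitz_upper _ _ _ _) uu) il /XP]; lia.
pose w : 'M[K]_n := (perm_mx s)^T.
have uw : w \in unitmx by rewrite unitmx_tr unitmx_perm.
pose d := perm_mx s *m (D + Y) *m w.
have bw : b *m w = u *m w *m d.
  have wK : w *m perm_mx s = 1%:M by rewrite /w tr_perm_mx -perm_mxM mulVg perm_mx1.
  rewrite /d !mulmxA -[u *m w *m _]mulmxA wK mulmx1 mulmxDr mulKVmx //.
  by rewrite addrC subrK.
exists d; split=> //.
  (* [D] stays diagonal under [s], and [Y] stays above the blocks because [s] preserves them. *)
  move=> i j; rewrite mulmx_tr_perm -row_permE 2!mxE [D _ _]mxE.
  have [->|Yn0 _] := eqVneq (Y (s i) (s j)) 0.
    by case: (eqVneq (s i) (s j)) => [/perm_inj ->//|_]; rewrite mulr0n addr0 eqxx.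
  have := YP _ _ Yn0; rewrite !hs block_start_rev => /ltn_block_start_rev.
  by rewrite block_revK; have := block_start_le c j; lia.
have : b *m w \in unitmx by rewrite unitmx_mul ub.
by rewrite bw unitmx_mul => /andP[].
Qed.

(** * Translation of cosets into matrices in the basis [P] *)

Definition from_basis (R : realType) (n : nat) (P A : 'M[R[i]]_n) : 'M[R[i]]_n :=
  P *m A *m invmx P.

Definition flag_of (R : realType) (n : nat) (P A : 'M[R[i]]_n) : set 'M[R[i]]_n :=
  borel_coset P (from_basis P A).

Lemma from_basisK (R : realType) (n : nat) (P A : 'M[R[i]]_n) :
  P \in unitmx -> in_basis P (from_basis P A) = A.
Proof. by move=> uP; rewrite /in_basis /from_basis -!mulmxA mulVmx // mulmx1 mulKmx. Qed.

Lemma in_basisK (R : realType) (n : nat) (P A : 'M[R[i]]_n) :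
  P \in unitmx -> from_basis P (in_basis P A) = A.
Proof. by move=> uP; rewrite /in_basis /from_basis -!mulmxA mulmxV // mulmx1 mulKVmx. Qed.

Lemma in_basisM (R : realType) (n : nat) (P A B : 'M[R[i]]_n) :
  P \in unitmx -> in_basis P (A *m B) = in_basis P A *m in_basis P B.
Proof. by move=> uP; rewrite /in_basis -!mulmxA mulKVmx. Qed.

Lemma from_basisM (R : realType) (n : nat) (P A B : 'M[R[i]]_n) :
  P \in unitmx -> from_basis P (A *m B) = from_basis P A *m from_basis P B.
Proof. by move=> uP; rewrite /from_basis -!mulmxA mulKmx. Qed.

Lemma in_basis_unit (R : realType) (n : nat) (P A : 'M[R[i]]_n) :
  P \in unitmx -> (in_basis P A \in unitmx) = (A \in unitmx).
Proof. by move=> uP; rewrite !unitmx_mul unitmx_inv uP andbT. Qed.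

Lemma from_basis_unit (R : realType) (n : nat) (P A : 'M[R[i]]_n) :
  P \in unitmx -> (from_basis P A \in unitmx) = (A \in unitmx).
Proof. by move=> uP; rewrite !unitmx_mul unitmx_inv uP andbT. Qed.

Lemma borel_groupP (R : realType) (n : nat) (P b : 'M[R[i]]_n) : P \in unitmx ->
  borel_group P b <-> upper_mx (in_basis P b) /\ in_basis P b \in unitmx.
Proof.
move=> uP; rewrite in_basis_unit //.
by split=> [[? /upper_mx_trig]|[/upper_mx_trig ? ?]].
Qed.

Lemma borel_coset_flag (R : realType) (n : nat) (P g : 'M[R[i]]_n) : P \in unitmx ->
  borel_coset P g = flag_of P (in_basis P g).
Proof. by move=> uP; rewrite /flag_of in_basisK. Qed.

Lemma flag_ofP (R : realType) (n : nat) (P A g : 'M[R[i]]_n) : P \in unitmx ->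
  flag_of P A g <->
  exists b, [/\ upper_mx b, b \in unitmx & in_basis P g = A *m b].
Proof.
move=> uP; split=> [[b /borel_groupP[] // hb ub <-]|[b [hb ub gE]]].
  by exists (in_basis P b); split; rewrite // in_basisM // from_basisK.
exists (from_basis P b); first by apply/borel_groupP; rewrite // from_basisK.
by rewrite -from_basisM // -gE in_basisK.
Qed.

Lemma flag_of_self (R : realType) (n : nat) (P A : 'M[R[i]]_n) : P \in unitmx ->
  flag_of P A (from_basis P A).
Proof.
move=> uP; apply/flag_ofP => //; exists 1%:M.
by rewrite from_basisK // mulmx1 unitmx1; split=> //; apply: upper_mx1.
Qed.

Lemma flag_of_eq (R : realType) (n : nat) (P A B : 'M[R[i]]_n) : P \in unitmx ->
  flag_of P A = flag_of P B <->
  exists b, [/\ upper_mx b, b \in unitmx & B = A *m b].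
Proof.
move=> uP; split=> [AB|[b [hb ub ->]]].
  have := flag_of_self B uP; rewrite -AB => /(flag_ofP _ _ uP)[b [hb ub]].
  by rewrite from_basisK // => ->; exists b.
apply/seteqP; split=> g /(flag_ofP _ _ uP)[d [hd ud gE]]; apply/flag_ofP => //.
  exists (invmx b *m d); split.
  - exact: upper_mxM (upper_mxV hb ub) hd.
  - by rewrite unitmx_mul unitmx_inv ub.
  - by rewrite gE -mulmxA mulKVmx.
exists (b *m d); rewrite unitmx_mul ub mulmxA; split=> //; exact: upper_mxM.
Qed.

Lemma hessenberg_spaceP (R : realType) (n : nat) (P X : 'M[R[i]]_n) :
  hessenberg_space P X <-> forall i j, in_basis P X i j != 0 -> (i <= j.+1)%N.
Proof.
have sumE (a : 'I_n -> R[i]) (r q : 'I_n) :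
    (\sum_(j < n) \sum_(i < n | i == j.+1 :> nat) a j *: delta_mx i j : 'M[R[i]]_n) r q =
    if r == q.+1 :> nat then a q else 0.
  rewrite summxE (bigD1 q) //= [X in _ + X]big1 ?addr0 => [|j jq]; last first.
    by rewrite summxE big1 // => i _; rewrite !mxE [q == j]eq_sym (negPf jq) andbF mulr0.
  rewrite summxE; case: (r =P q.+1 :> nat) => [rq|nrq].
    rewrite (bigD1 r) ?rq //= big1 => [|i /andP[_ ir]].
      by rewrite addr0 !mxE !eqxx mulr1.
    by rewrite !mxE eq_sym (negPf ir) mulr0.
  rewrite big1 // => i /eqP iq; rewrite !mxE; case: (r =P i) => [ri|_]; last by rewrite mulr0.
  by case: nrq; rewrite ri.
split=> [[Y [a [/upper_mx_trig hY ->]]] i j|h].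
  rewrite mxE sumE; case: (i =P j.+1 :> nat) => [-> //|_].
  by rewrite addr0 => /hY; lia.
exists (\matrix_(i, j) if (i <= j)%N then in_basis P X i j else 0).
(* The default 0 concerns the last column, which has no subdiagonal entry. *)
exists (fun q : 'I_n => if insub q.+1 is Some r then in_basis P X r q else 0); split.
  by apply/upper_mx_trig => i j; rewrite mxE; case: ifP; rewrite ?eqxx.
apply/matrixP => r q; rewrite [RHS]mxE sumE [X in X + _]mxE.
case: leqP => rq; first by rewrite ifN ?addr0 //; lia.
case: (r =P q.+1 :> nat) => [rq1|nrq].
  by rewrite add0r -rq1 valK.
by rewrite addr0; apply: contra_notP nrq => /eqP /h; lia.
Qed.

(** In the basis [P] the operator [N] is the shift; an intertwining relation replaces the
    conjugation and its inverse. *)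
Lemma hessenberg_conj (R : realType) (n : nat) (P N g : 'M[R[i]]_n) :
  jordan_basis P N -> g \in unitmx ->
  hessenberg_space P (invmx g *m N *m g) <->
  exists2 X, shift_mx _ n *m in_basis P g = in_basis P g *m X &
    forall i j, X i j != 0 -> (i <= j.+1)%N.
Proof.
move=> [uP NE] ug; rewrite hessenberg_spaceP.
have gX : shift_mx _ n *m in_basis P g = in_basis P g *m in_basis P (invmx g *m N *m g).
  have NgE : N *m g = g *m (invmx g *m N *m g) by rewrite !mulmxA mulmxV // mul1mx.
  by rewrite -in_basisM // -NgE in_basisM // NE.
split=> [h|[X XE hX]]; first by exists (in_basis P (invmx g *m N *m g)).
suff -> : in_basis P (invmx g *m N *m g) = X by [].
have u : in_basis P g \in unitmx by rewrite in_basis_unit.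
by rewrite -[LHS](mulKmx u) -gX XE mulKmx.
Qed.

(** The Hessenberg shape is stable under conjugation by upper triangular matrices, so it can be
    tested on the Schubert representative b w of the coset. *)
Lemma peterson_cellP (R : realType) (n : nat) (P N : 'M[R[i]]_n) (s : 'S_n)
    (C : set 'M[R[i]]_n) : jordan_basis P N ->
  peterson_cell P N s C <->
  exists b M, [/\ upper_mx b, b \in unitmx, shift_mx _ n *m b = b *m M,
    perm_hessenberg s M & C = flag_of P (b *m (perm_mx s)^T)].
Proof.
move=> hPN; have uP := hPN.1; set w := (perm_mx s)^T.
have uw : w \in unitmx by rewrite unitmx_tr unitmx_perm.
have wK : w *m perm_mx s = 1%:M by rewrite /w tr_perm_mx -perm_mxM mulVg perm_mx1.
have weylE b : borel_coset P (b *m weyl_mx P s) = flag_of P (in_basis P b *m w).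
  by rewrite /flag_of from_basisM // in_basisK.
split=> [[[b0 /borel_groupP[]// hb ub <-]]|[b [M [hb ub bM hM ->]]]].
  rewrite weylE => -[g [ug /(hessenberg_conj hPN ug)[X XE hX]]].
  rewrite borel_coset_flag // => /(flag_of_eq _ _ uP)[d [hd ud bE]].
  move: (in_basis P g) (in_basis P b0) hb ub bE XE => g' b hb ub bE XE.
  set Z := invmx d *m X *m d; exists b, (w *m Z *m perm_mx s); split => //.
    rewrite -[LHS]mulmx1 -wK !mulmxA; congr (_ *m _).
    by rewrite -[LHS]mulmxA bE !mulmxA XE mulmxK.
  have hZ i j : Z i j != 0 -> (i <= j.+1)%N.
    by move=> /mulmx_support[l /mulmx_support[k /(upper_mxV hd ud) ? /hX ?] /hd]; lia.
  move=> i j; have -> : (w *m Z *m perm_mx s) (s i) (s j) = Z i j; last exact: hZ.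
  rewrite /w tr_perm_mx -row_permE -[X in _ *m perm_mx X]invgK -col_permE.
  by rewrite 2!mxE !permK.
split.
  exists (from_basis P b); first by apply/borel_groupP; rewrite ?from_basisK.
  by rewrite weylE from_basisK.
have ubw : b *m w \in unitmx by rewrite unitmx_mul ub.
exists (from_basis P (b *m w)); last by [].
split; first by rewrite /GL_set /= from_basis_unit.
apply/(hessenberg_conj hPN); rewrite ?from_basis_unit // from_basisK //.
exists (perm_mx s *m M *m w); last by move=> i j; rewrite mulmx_tr_perm -row_permE mxE; apply: hM.
by rewrite !mulmxA bM -[b *m w *m _]mulmxA wK mulmx1.
Qed.

(** * Coordinates on the cells *)

(** The coordinates [e] are a parameter: the identity on affine space, or the entries of a
    matrix. *)
Definition polynomial_on (K : comNzRingType) (X : Type) (k : nat)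
    (e : X -> 'I_k -> K) (f : X -> K) : Prop :=
  exists q : {mpoly K[k]}, forall x, q.@[e x] = f x.

Lemma polynomial_on_cst (K : comNzRingType) (X : Type) (k : nat)
    (e : X -> 'I_k -> K) (a : K) : polynomial_on e (fun=> a).
Proof. by exists a%:MP => x; rewrite mevalC. Qed.

Lemma polynomial_on_comp (K : comNzRingType) (X : Type) (k l : nat)
    (e : X -> 'I_k -> K) (y : X -> 'I_l -> K) (p : {mpoly K[l]}) :
  (forall i, polynomial_on e (fun x => y x i)) -> polynomial_on e (fun x => p.@[y x]).
Proof.
move=> ye; elim/mpoly_ring_ind: p => [c|i|p q [P hP] [Q hQ]|p q [P hP] [Q hQ]].
- by exists c%:MP => x; rewrite !mevalC.
- by have [q hq] := ye i; exists q => x; rewrite mevalXU.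
- by exists (P + Q) => x; rewrite !mevalD hP hQ.
- by exists (P * Q) => x; rewrite !mevalM hP hQ.
Qed.

Lemma polynomial_on_mulmx (K : comNzRingType) (X : Type) (k a b c : nat)
    (e : X -> 'I_k -> K) (A : X -> 'M[K]_(a, b)) (B : X -> 'M[K]_(b, c)) :
  (forall i j, polynomial_on e (fun x => A x i j)) ->
  (forall i j, polynomial_on e (fun x => B x i j)) ->
  forall i j, polynomial_on e (fun x => (A x *m B x) i j).
Proof.
move=> hA hB i j; have [f hf] := choice (hA i); have [g hg] := choice (hB^~ j).
exists (\sum_l f l * g l) => x; rewrite mxE raddf_sum /=.
by apply: eq_bigr => l _; rewrite mevalM hf hg.
Qed.

Lemma polynomial_on_mxvec (K : comNzRingType) (X : Type) (k n : nat)
    (e : X -> 'I_k -> K) (A : X -> 'M[K]_n) (p : {mpoly K[n * n]}) :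
  (forall i j, polynomial_on e (fun x => A x i j)) ->
  polynomial_on e (fun x => p.@[mxvec (A x) 0]).
Proof.
move=> hA; apply: polynomial_on_comp => l; case/mxvec_indexP: l => i j.
by have [q hq] := hA i j; exists q => x; rewrite mxvecE.
Qed.

Lemma polynomial_on_entry (K : comNzRingType) (n : nat) (i j : 'I_n) :
  polynomial_on (fun g : 'M[K]_n => mxvec g 0) (fun g => g i j).
Proof. by exists 'X_(mxvec_index i j) => g; rewrite mevalXU mxvecE. Qed.

Definition interior_set (n : nat) (c : seq nat) : {set 'I_n} :=
  [set i : 'I_n | block_start c i != i :> nat].

Lemma card_interior_set (n : nat) (c : seq nat) :
  ordered_partitions n c -> #|interior_set n c| = (n - size c)%N.
Proof.
move=> [pos_c sum_c]; rewrite -(count_block_start pos_c) sum_c -val_enum_ord count_map.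
rewrite cardE size_filter -enumT.
rewrite -[X in (X - _)%N](size_enum_ord n).
rewrite -(count_predC (fun i : 'I_n => block_start c i == i :> nat)).
rewrite addKn; apply: eq_count => i; by rewrite /= inE.
Qed.

(** The default 1 covers the block starts, which makes the sequence normalized. *)
Definition toeplitz_coord (K : nzSemiRingType) (n : nat) (c : seq nat)
    (v : 'I_#|interior_set n c| -> K) (p : nat) : K :=
  if [pick k : 'I_#|interior_set n c| | (enum_val k : 'I_n) == p :> nat] is Some k then v k else 1.

Lemma toeplitz_coord_val (K : nzSemiRingType) (n : nat) (c : seq nat)
    (v : 'I_#|interior_set n c| -> K) (k : 'I_#|interior_set n c|) :
  toeplitz_coord v (enum_val k : 'I_n) = v k.
Proof.
rewrite /toeplitz_coord; case: pickP => [l /eqP/val_inj/enum_val_inj -> //|/(_ k)].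
by rewrite eqxx.
Qed.

Lemma toeplitz_coord_normalized (K : nzSemiRingType) (n : nat) (c : seq nat)
    (v : 'I_#|interior_set n c| -> K) : start_normalized c (toeplitz_coord v).
Proof.
move=> i si; rewrite /toeplitz_coord; case: pickP => [k /eqP ki|//].
by have := enum_valP k; rewrite inE ki si eqxx.
Qed.

(** Only the matrices are compared: the sequences may differ from index [n] on, which the matrix
    does not read. *)
Lemma toeplitz_coord_onto (K : nzSemiRingType) (n : nat) (c : seq nat) (t : nat -> K) :
  start_normalized c t ->
  exists v : 'I_#|interior_set n c| -> K, toeplitz_mx n c (toeplitz_coord v) = toeplitz_mx n c t.
Proof.
move=> ht; exists (fun k => t (enum_val k : 'I_n)); apply/matrixP => i j; rewrite !mxE.
case: ifP => // /andP[/eqP sij ij].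
have pn : (block_start c i + (j - i) < n)%N.
  by have := block_start_le c i; have := ltn_ord j; lia.
set p := Ordinal pn; rewrite /toeplitz_coord; case: pickP => [k /eqP -> //|none].
have [sp|np] := eqVneq (block_start c p) p; first by rewrite ht.
have pin : p \in interior_set n c by rewrite inE.
by have := none (enum_rank_in pin p); rewrite enum_rankK_in ?eqxx.
Qed.

Definition cell_flag (R : realType) (n : nat) (P : 'M[R[i]]_n) (c : seq nat) (s : 'S_n)
    (v : 'I_#|interior_set n c| -> R[i]) : set 'M[R[i]]_n :=
  flag_of P (toeplitz_mx n c (toeplitz_coord v) *m (perm_mx s)^T).

Lemma peterson_cell_range (R : realType) (n : nat) (P N : 'M[R[i]]_n) (c : seq nat)
    (s : 'S_n) : jordan_basis P N -> reverses c s ->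
  peterson_cell P N s = range (@cell_flag R n P c s).
Proof.
move=> hPN hs; have uP := hPN.1; apply/seteqP; split => [C|_ [v _ <-]].
  move=> /(peterson_cellP _ _ hPN)[b [M [hb ub bM hM ->]]].
  have [t ht [d [hd ud bE]]] := hessenberg_toeplitz hs hb ub bM hM.
  have [v vE] := toeplitz_coord_onto n ht.
  exists v; first by [].
  by rewrite /cell_flag vE; apply/(flag_of_eq _ _ uP); exists d.
have hv := toeplitz_coord_normalized v.
have [M uM hM] := toeplitz_hessenberg hs hv.
apply/(peterson_cellP _ _ hPN); exists (toeplitz_mx n c (toeplitz_coord v)), M.
by split=> //; [exact: toeplitz_upper | exact: toeplitz_unit].
Qed.

(** Every coordinate is thus a ratio of two entries in the same column, whichever representative [g]
    is taken. *)
Lemma cell_flag_entry (R : realType) (n : nat) (P g : 'M[R[i]]_n) (c : seq nat)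
    (s : 'S_n) (v : 'I_#|interior_set n c| -> R[i]) :
  P \in unitmx -> reverses c s -> cell_flag P s v g ->
  forall i, let p := block_start_ord c i in
    in_basis P g (s p) p != 0 /\
    in_basis P g (s i) p = toeplitz_coord v i * in_basis P g (s p) p.
Proof.
move=> uP hs /(flag_ofP _ _ uP)[b [hb ub ->]] i p.
have hv := toeplitz_coord_normalized v.
have pE : block_start_ord c p = p by apply/val_inj; rewrite /= block_startK.
have := toeplitz_schubert_entry (toeplitz_coord v) p hs hb; rewrite /= pE => ->.
rewrite (toeplitz_schubert_entry _ _ hs hb) hv; last exact: block_startK.
by rewrite mul1r; split=> //; apply: upper_mx_diag.
Qed.

(** Coordinates are ratios of entries, and fractions can be added and multiplied; the pair [p], [q]
    serves all flags of the cell at once. *)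
Lemma cell_flag_rational (R : realType) (n : nat) (P : 'M[R[i]]_n) (c : seq nat)
    (s : 'S_n) (h : {mpoly R[i][#|interior_set n c|]}) :
  P \in unitmx -> reverses c s ->
  exists p q : {mpoly R[i][n * n]}, forall g v, cell_flag P s v g ->
    q.@[mxvec g 0] != 0 /\ p.@[mxvec g 0] = h.@[v] * q.@[mxvec g 0].
Proof.
move=> uP hs.
have entry i j : polynomial_on (fun g : 'M[R[i]]_n => mxvec g 0) (fun g => in_basis P g i j).
  apply: polynomial_on_mulmx => [{}i {}j|*]; last exact: polynomial_on_cst.
  by apply: polynomial_on_mulmx => *; [exact: polynomial_on_cst | exact: polynomial_on_entry].
elim/mpoly_ring_ind: h => [a|k|h1 h2 [p1 [q1 h1E]] [p2 [q2 h2E]]|h1 h2 [p1 [q1 h1E]] [p2 [q2 h2E]]].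
- by exists a%:MP, 1 => g v _; rewrite meval1 !mevalC mulr1 oner_eq0.
- set i : 'I_n := enum_val k; set i0 := block_start_ord c i.
  have [p pE] := entry (s i) i0; have [q qE] := entry (s i0) i0.
  exists p, q => g v gv; have [q0 pq] := cell_flag_entry uP hs gv i.
  by rewrite pE qE pq mevalXU -(toeplitz_coord_val v k).
- exists (p1 * q2 + p2 * q1), (q1 * q2) => g v gv.
  have [n1 e1] := h1E g v gv; have [n2 e2] := h2E g v gv.
  by rewrite !(mevalD, mevalM) mulf_neq0 // e1 e2; split=> //; ring.
- exists (p1 * p2), (q1 * q2) => g v gv.
  have [n1 e1] := h1E g v gv; have [n2 e2] := h2E g v gv.
  by rewrite !mevalM mulf_neq0 // e1 e2; split=> //; ring.
Qed.

Lemma cell_flag_inj (R : realType) (n : nat) (P : 'M[R[i]]_n) (c : seq nat) (s : 'S_n) :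
  P \in unitmx -> reverses c s -> injective (@cell_flag R n P c s).
Proof.
move=> uP hs v w vw; apply/funext => k; rewrite -!toeplitz_coord_val.
have gv := flag_of_self (toeplitz_mx n c (toeplitz_coord v) *m (perm_mx s)^T) uP.
have [n0 ve] := cell_flag_entry uP hs gv (enum_val k).
move: gv; rewrite -/(cell_flag P s v) vw => gw.
have [_ we] := cell_flag_entry uP hs gw (enum_val k).
by apply: (mulIf n0); rewrite -ve -we.
Qed.

Lemma cell_flag_continuous (R : realType) (n : nat) (P : 'M[R[i]]_n) (c : seq nat)
    (s : 'S_n) (F : set (set 'M[R[i]]_n)) : P \in unitmx ->
  zariski_closed_flag P F -> zariski_closed_affine (@cell_flag R n P c s @^-1` F).
Proof.
move=> uP [_ [I FI]].
pose A (v : 'I_#|interior_set n c| -> R[i]) :=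
  from_basis P (toeplitz_mx n c (toeplitz_coord v) *m (perm_mx s)^T).
have uA v : A v \in unitmx.
  rewrite from_basis_unit // unitmx_mul unitmx_tr unitmx_perm andbT.
  exact/toeplitz_unit/toeplitz_coord_normalized.
have FA v : F (cell_flag P s v) <-> forall p, I p -> p.@[mxvec (A v) 0] = 0.
  have /seteqP[FI1 FI2] := FI; split=> [Fv p Ip|h].
    by have [] := FI1 (A v) (conj (uA v) Fv); move=> _ /(_ p Ip).
  by have [] := FI2 (A v) (conj (uA v) h).
exists [set q | exists2 p, I p & forall v, q.@[v] = p.@[mxvec (A v) 0]].
apply/seteqP; split=> [v /FA h q [p Ip ->]|v h]; first exact: h.
apply/FA => p Ip.
have [i j|q qE] := @polynomial_on_mxvec _ _ _ _ id A p; last by rewrite -qE; apply: h; exists p.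
rewrite /A; move: i j; apply: polynomial_on_mulmx => [i j|*]; last exact: polynomial_on_cst.
move: i j; apply: polynomial_on_mulmx => [*|i j]; first exact: polynomial_on_cst.
move: i j; apply: polynomial_on_mulmx => [i j|*]; last exact: polynomial_on_cst.
case cond: ((block_start c i == block_start c j) && (i <= j)%N); last first.
  by exists 0 => x; rewrite meval0 mxE cond.
case pk: [pick k : 'I_#|interior_set n c| |
    (enum_val k : 'I_n) == (block_start c i + (j - i))%N :> nat] => [k|].
  by exists 'X_k => x; rewrite mevalXU mxE cond /toeplitz_coord pk.
by exists 1 => x; rewrite meval1 mxE cond /toeplitz_coord pk.
Qed.

(** Equations in the coordinates are replaced by their numerators, which on the cell have the same
    zeros because the denominators do not vanish there. *)
Lemma cell_flag_closed (R : realType) (n : nat) (P : 'M[R[i]]_n) (c : seq nat)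
    (s : 'S_n) (G : set ('I_#|interior_set n c| -> R[i])) : P \in unitmx ->
  reverses c s -> zariski_closed_affine G ->
  exists2 F, zariski_closed_flag P F & @cell_flag R n P c s @^-1` F = G.
Proof.
move=> uP hs [I ->].
pose numerator := [set p : {mpoly R[i][n * n]} | exists2 h, I h &
  exists q : {mpoly R[i][n * n]}, forall g v, cell_flag P s v g ->
    q.@[mxvec g 0] != 0 /\ p.@[mxvec g 0] = h.@[v] * q.@[mxvec g 0]].
exists [set C | flag_variety P C /\ forall g, C g -> forall p, numerator p -> p.@[mxvec g 0] = 0].
  split; first by move=> C [].
  (* Imposing a numerator on all representatives g b of the flag gives, for each b, a polynomial
     equation in g. *)
  exists [set q | exists b p, [/\ borel_group P b, numerator p &
    forall g, q.@[mxvec g 0] = p.@[mxvec (g *m b) 0]]].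
  apply/seteqP; split=> g [ug].
    move=> [_ h]; split=> // q [b [p [hb hp ->]]].
    by apply: h hp; exists b.
  move=> h; split=> //; split; first by exists g.
  move=> _ [b hb <-] p hp.
  have [i j|q qE] := @polynomial_on_mxvec _ _ _ _ (fun g : 'M[R[i]]_n => mxvec g 0) (mulmxr b) p.
    apply: polynomial_on_mulmx => *; [exact: polynomial_on_entry | exact: polynomial_on_cst].
  by rewrite -[LHS]qE; apply: h; exists b, p.
apply/seteqP; split=> v.
  move=> [_ h] f If; have [p [q pq]] := cell_flag_rational f uP hs.
  have gv := flag_of_self (toeplitz_mx n c (toeplitz_coord v) *m (perm_mx s)^T) uP.
  have [q0 /esym/eqP] := pq _ _ gv; rewrite (h _ gv p); last by exists f => //; exists q.
  by rewrite mulf_eq0 (negPf q0) orbF => /eqP.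
move=> h; split.
  exists (from_basis P (toeplitz_mx n c (toeplitz_coord v) *m (perm_mx s)^T)) => //.
  rewrite /GL_set /= from_basis_unit // unitmx_mul unitmx_tr unitmx_perm andbT.
  exact/toeplitz_unit/toeplitz_coord_normalized.
by move=> g gv p [f If [q /(_ g v gv)[_ ->]]]; rewrite h // mul0r.
Qed.

Lemma complex_dim_peterson_cell (R : realType) (n : nat) (P N : 'M[R[i]]_n)
    (c : seq nat) (s : 'S_n) : jordan_basis P N -> ordered_partitions n c ->
  reverses c s -> complex_dim P (peterson_cell P N s) (n - size c).
Proof.
move=> hPN hc hs; rewrite /complex_dim (peterson_cell_range hPN hs) -card_interior_set //.
apply: (krull_dim_homeo (cell_flag_inj hPN.1 hs)) (krull_dim_affine _ _) => [F|G].
  exact: cell_flag_continuous hPN.1.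
exact: cell_flag_closed hPN.1 hs.
Qed.

(** * Nonempty cells and their permutations *)

Lemma peterson_cell_descent (R : realType) (n : nat) (P N : 'M[R[i]]_n) (s : 'S_n) :
  jordan_basis P N -> peterson_cell P N s !=set0 ->
  forall i j : 'I_n, j = i.+1 :> nat -> ((s^-1)%g i <= ((s^-1)%g j).+1)%N.
Proof.
move=> hPN [C /(peterson_cellP _ _ hPN)[b [M [hb ub bM hM _]]]] i j ij.
apply: hM; rewrite !permKV; have [_ /(_ _ _ ij) bE] := shift_conj_upper hb ub bM.
by have := upper_mx_diag j hb ub; rewrite bE mulf_eq0 negb_or => /andP[].
Qed.

(** This is disjointness of Schubert cells: the diagonal entry d i i is nonzero and equals the entry
    (s i, s' i) of the upper triangular matrix b^-1 b'. *)
Lemma peterson_cell_le (R : realType) (n : nat) (P N : 'M[R[i]]_n) (s s' : 'S_n)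
    (C : set 'M[R[i]]_n) : jordan_basis P N ->
  peterson_cell P N s C -> peterson_cell P N s' C -> forall i, (s i <= s' i)%N.
Proof.
move=> hPN /(peterson_cellP _ _ hPN)[b [_ [hb ub _ _ ->]]].
move=> /(peterson_cellP _ _ hPN)[b' [_ [hb' ub' _ _]]] /(flag_of_eq _ _ hPN.1)[d [hd ud bE]] i.
have dE : d = perm_mx s *m (invmx b *m b') *m (perm_mx s')^T.
  by rewrite -!mulmxA bE -!mulmxA mulKmx // tr_perm_mx !mulmxA -perm_mxM mulgV perm_mx1 mul1mx.
apply: (upper_mxM (upper_mxV hb ub) hb').
by have := upper_mx_diag i hd ud; rewrite dE mulmx_tr_perm -row_permE mxE.
Qed.

Lemma peterson_cell_inj (R : realType) (n : nat) (P N : 'M[R[i]]_n) (s s' : 'S_n)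
    (C : set 'M[R[i]]_n) : jordan_basis P N ->
  peterson_cell P N s C -> peterson_cell P N s' C -> s = s'.
Proof.
move=> hPN Cs Cs'; apply/permP => i; apply/val_inj/eqP.
by rewrite eqn_leq (peterson_cell_le hPN Cs Cs') (peterson_cell_le hPN Cs' Cs).
Qed.

Lemma reverses_exists (n : nat) (c : seq nat) :
  ordered_partitions n c -> exists s : 'S_n, reverses c s.
Proof.
move=> [_ sum_c].
have lt_rev (i : 'I_n) : (block_rev c i < n)%N.
  by rewrite -[X in (_ < X)%N]sum_c block_rev_ltn // sum_c.
have inj_rev : injective (fun i => Ordinal (lt_rev i)).
  by move=> i j /(congr1 val) /= /(can_inj (@block_revK c)) /val_inj.
by exists (perm inj_rev) => i; rewrite permE.
Qed.

Lemma one_line_reverses (n : nat) (c : seq nat) (s : 'S_n) :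
  ordered_partitions n c -> reverses c s -> one_line s = block_reversal n c.
Proof.
move=> [_ sum_c] hs; apply: (@eq_from_nth _ 0%N).
  by rewrite size_map size_enum_ord size_block_reversal.
move=> i; rewrite size_map size_enum_ord => lt_in.
rewrite (nth_map (Ordinal lt_in)) ?size_enum_ord // nth_block_reversal // hs.
by rewrite nth_enum_ord.
Qed.

Lemma reverses_inj (n : nat) (c d : seq nat) (s : 'S_n) :
  ordered_partitions n c -> ordered_partitions n d ->
  reverses c s -> reverses d s -> c = d.
Proof.
move=> [pos_c sum_c] [pos_d sum_d] cs ds.
apply: block_rev_inj => //; first by rewrite sum_c sum_d.
by move=> i; rewrite sum_c => lt_in; rewrite -(cs (Ordinal lt_in)) ds.
Qed.

Lemma reverses_uniq (n : nat) (c : seq nat) (s s' : 'S_n) :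
  reverses c s -> reverses c s' -> s = s'.
Proof. by move=> hs hs'; apply/permP => i; apply/val_inj; rewrite /= hs hs'. Qed.

Lemma peterson_cell_reverses (R : realType) (n : nat) (P N : 'M[R[i]]_n) (s : 'S_n) :
  jordan_basis P N -> peterson_cell P N s !=set0 ->
  exists2 c, ordered_partitions n c & reverses c s.
Proof.
move=> hPN ne; have desc := peterson_cell_descent hPN ne.
(* The descent bound concerns the inverse of [s]; a block reversal is an involution, so the
   conclusion passes to [s]. *)
pose t i := if insub i is Some j then ((s^-1)%g j : 'I_n) : nat else 0%N.
pose u i := if insub i is Some j then (s j : 'I_n) : nat else 0%N.
have tE (i : 'I_n) : t i = (s^-1)%g i by rewrite /t valK.
have uE (i : 'I_n) : u i = s i by rewrite /u valK.
have [i lt_in|i lt_in|i lt_in|c [pos_c sum_c] tc] := @block_rev_exists n t u.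
- by rewrite (tE (Ordinal lt_in)) uE permKV.
- by rewrite (uE (Ordinal lt_in)) tE permK.
- by rewrite (tE (Ordinal lt_in)) (tE (Ordinal (ltnW lt_in))); apply: desc.
exists c => // i; have rev_si : block_rev c (s i) = i by rewrite -tc // tE permK.
by rewrite -[LHS](block_revK c) rev_si.
Qed.

(** * Counting ordered partitions and cells *)

Lemma size_le_sumn (c : seq nat) : all (ltn 0) c -> (size c <= sumn c)%N.
Proof. by elim: c => //= m c IH /andP[m0 /IH]; lia. Qed.

Lemma mem_le_sumn (c : seq nat) (i : nat) :
  all (ltn 0) c -> i \in c -> (i + size c <= (sumn c).+1)%N.
Proof.
elim: c => //= m c IH /andP[m0 pos_c]; rewrite inE => /orP[/eqP ->|/IH].
  by have := size_le_sumn pos_c; lia.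
by move=> /(_ pos_c); lia.
Qed.

(** Subtracting 1 from each part leaves m + 1 natural numbers with sum d = n - m - 1. Each is at
    most d, so they form a tuple over ['I_d.+1], and [card_ord_partitions] counts these. *)
Lemma enum_ordered_partitions (n m : nat) : (m < n)%N ->
  exists2 e : nat -> seq nat, {in `I_('C(n.-1, m)) &, injective e} &
    e @` `I_('C(n.-1, m)) = [set c | ordered_partitions n c /\ size c = m.+1].
Proof.
move=> mn; pose d := (n - m.+1)%N.
pose D := [set t : m.+1.-tuple 'I_d.+1 | (\sum_(i <- t) i)%N == d]%SET.
have cardD : #|D| = 'C(n.-1, m) by rewrite card_ord_partitions; congr 'C(_, _); rewrite /d; lia.
pose shift (t : m.+1.-tuple 'I_d.+1) : seq nat := [seq (val i).+1 | i <- t].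
have shift_inj : injective shift.
  by move=> t u; rewrite /shift => /(inj_map (inj_comp succn_inj val_inj)) /val_inj.
pose t0 : m.+1.-tuple 'I_d.+1 := [tuple of nseq m.+1 ord0].
have sum_shift (t : seq 'I_d.+1) : sumn [seq (val i).+1 | i <- t] = (\sum_(i <- t) i + size t)%N.
  by elim: t => [|i t IH] /=; rewrite ?big_nil // big_cons IH; lia.
exists (fun i => shift (nth t0 (enum D) i)).
  move=> i j /set_mem /= iD /set_mem /= jD /shift_inj /eqP.
  by rewrite nth_uniq ?enum_uniq -?cardE ?cardD // => /eqP.
apply/seteqP; split=> [_ [i iD <-]|c [[pos_c sum_c] size_c]].
  set t := nth t0 (enum D) i.
  have : t \in D by rewrite -mem_enum mem_nth // -cardE cardD.
  rewrite inE => /eqP sum_t; split; last by rewrite /= size_map size_tuple.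
  split; first by apply/allP => _ /mapP[j _ ->].
  by rewrite sum_shift sum_t size_tuple /d subnK.
have size_t : size [seq inord i.-1 : 'I_d.+1 | i <- c] == m.+1 by rewrite size_map size_c.
pose t := Tuple size_t.
have tc : shift t = c.
  rewrite /shift -map_comp -[RHS]map_id; apply/eq_in_map => i ic /=.
  have i0 := allP pos_c i ic.
  rewrite inordK prednK //.
  by have := mem_le_sumn pos_c ic; rewrite sum_c size_c /d; lia.
have tD : t \in D.
  have := sum_c; rewrite -tc sum_shift size_tuple => sum_t.
  by rewrite inE; apply/eqP/(@addIn m.+1); rewrite sum_t /d subnK.
exists (index t (enum D)); last by rewrite nth_index ?mem_enum.
by rewrite /= -cardD cardE index_mem mem_enum.
Qed.

Theorem theorem25 (R : realType) (n : nat) (hn : (0 < n)%N)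
    (N : 'M[R[i]]_n) (hN : regular_nilpotent N)
    (P : 'M[R[i]]_n) (hP : jordan_basis P N) :
  (exists f : seq nat -> set (set 'M[R[i]]_n),
     set_bij (ordered_partitions n) (peterson_cells P N) f /\
     forall c : seq nat, ordered_partitions n c ->
       (exists2 s : 'S_n, one_line s = block_reversal n c &
          f c = peterson_cell P N s) /\
       complex_dim P (f c) (n - size c)) /\
  (forall k : nat,
     [set C | peterson_cells P N C /\ complex_dim P C k]
       #= `I_('C(n - 1, k))).
Proof.
have /choice[g hg] : forall c, exists s : 'S_n, ordered_partitions n c -> reverses c s.
  move=> c; have [/reverses_exists[s hs]|nc] := pselect (ordered_partitions n c).
    by exists s.
  by exists 1%g.
pose f c := peterson_cell P N (g c).
have dim_f c : ordered_partitions n c -> complex_dim P (f c) (n - size c).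
  by move=> hc; apply: complex_dim_peterson_cell => //; apply: hg.
have f_ne c : ordered_partitions n c -> f c !=set0.
  move=> hc; rewrite /f (peterson_cell_range hP (hg c hc)).
  by exists (@cell_flag R n P c (g c) (fun=> 0)); exists (fun=> 0).
have f_bij : set_bij (ordered_partitions n) (peterson_cells P N) f.
  split=> [c hc|c d|C [C0 [s Cs]]].
  - by split; [exact: f_ne | exists (g c)].
  - rewrite !inE => hc hd fcd; have [C Cc] := f_ne c hc.
    have gcd : g c = g d by apply: (peterson_cell_inj hP Cc); rewrite -/(f d) -fcd.
    by apply: (reverses_inj hc hd (hg c hc)); rewrite gcd; apply: hg.
  - rewrite Cs in C0 *; have [c hc cs] := peterson_cell_reverses hP C0.
    by exists c; [exact: hc | rewrite /f (reverses_uniq (hg c hc) cs)].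
have [f_fun f_inj f_surj] := f_bij.
split.
  exists f; split=> // c hc; split; last exact: dim_f.
  by exists (g c) => //; apply: one_line_reverses => //; apply: hg.
have size_le c : ordered_partitions n c -> (0 < size c <= n)%N.
  move=> [pos_c sum_c]; apply/andP; split; last by rewrite -sum_c size_le_sumn.
  by case: c sum_c {pos_c} => [n0|//]; rewrite -n0 in hn.
have cellsE k : [set C | peterson_cells P N C /\ complex_dim P C k] =
    f @` [set c | ordered_partitions n c /\ (n - size c)%N = k].
  apply/seteqP; split=> [C [/f_surj[c hc <-] dimC]|_ [c [hc <-] <-]].
    by exists c => //; split=> //; apply: krull_dim_uniq dimC; apply: dim_f.
  by split; [exact: f_fun | exact: dim_f].
move=> k; rewrite cellsE subn1.
(* Since [n] is positive there is at least one part, so no cell has dimension [n] or more. *)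
have [kn|nk] := ltnP k n; last first.
  rewrite bin_small; last lia.
  rewrite (_ : [set c | _] = set0) ?image_set0 ?II0 //.
  by apply/seteqP; split=> c // -[/size_le]; lia.
(* Dimension [k] means n - k = m + 1 parts; symmetry of the binomial coefficient turns [m] into
   [k]. *)
pose m := (n.-1 - k)%N; have mn : (m < n)%N by rewrite /m; lia.
have binE : 'C(n.-1, m) = 'C(n.-1, k) by rewrite /m bin_sub //; lia.
have [e e_inj eE] := enum_ordered_partitions mn; rewrite binE in e_inj eE.
have -> : [set c | ordered_partitions n c /\ (n - size c)%N = k] = e @` `I_('C(n.-1, k)).
  rewrite eE; apply/seteqP.
  by split=> c [hc hk]; split=> //; have := size_le c hc; rewrite /m in hk *; lia.
rewrite image_comp; apply: inj_card_eq => i j iK jK /= fe.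
have part_e l : l \in `I_('C(n.-1, k)) -> ordered_partitions n (e l).
  move=> /set_mem lK; have : (e @` `I_('C(n.-1, k))) (e l) by exists l.
  by rewrite eE => -[].
apply: (e_inj i j iK jK); apply: f_inj fe; rewrite inE; exact: part_e.
Qed.
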